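(* Let $\phi^0:[0,1]\to\mathbb R$ be $1$-Lipschitz with $\phi^0(0)=0$. For $L\in\mathbb N$ let $(h(t))_{t\ge0}$ be the corner-flip dynamics on $\Omega_{M_L,N_L}$ ($M_L+N_L=L$) started from $$h^0_x=2\lfloor L\phi^0(x/L)/2\rfloor\ (x\text{ even}),\qquad h^0_x=2\lfloor (L\phi^0(x/L)-1)/2\rfloor+1\ (x\text{ odd}),$$ ($M_L,N_L$ being determined by $h^0_L$). Then for all $T\ge0$ and $\varepsilon>0$, with probability tending to $1$ as $L\to\infty$, $$\sup_{t\in[0,T],\,x\in[0,1]}\frac1L\big|h_{\lfloor xL\rfloor}(L^2t)-L\phi(x,t)\big|\le\varepsilon,$$ where $\phi$ solves $\partial_t\phi=\frac12\partial_x^2\phi$ on $(0,1)\times(0,\infty)$ with $\phi(0,t)=0$, $\phi(1,t)=\phi^0(1)$ for $t>0$ and $\phi(x,0)=\phi^0(x)$.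
   Context: For positive integers $M,N$, $\Omega_{M,N}=\{(h_x)_{x\in\{0,\dots,M+N\}}\in\mathbb Z^{M+N+1}: |h_{x+1}-h_x|=1,\ h_0=0,\ h_{M+N}=M-N\}$. Write $L=M+N$. For $h\in\Omega_{M,N}$ and $x\in\{1,\dots,L-1\}$, $h^{(x)}$ agrees with $h$ off $x$ and $h^{(x)}_x=h_x-2$ if $h_{x\pm1}=h_x-1$, $h^{(x)}_x=h_x+2$ if $h_{x\pm1}=h_x+1$, and $h^{(x)}_x=h_x$ otherwise. The corner-flip dynamics is the Markov chain with generator $\mathcal Lf(h)=\frac12\sum_{x=1}^{L-1}(f(h^{(x)})-f(h))$. *)

(* Defs.v *)
From HB Require Import structures.
From mathcomp Require Import all_boot all_order all_algebra.
From mathcomp Require Import all_classical all_reals all_analysis.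
Set Implicit Arguments. Unset Strict Implicit. Unset Printing Implicit Defensive.
Import Order.TTheory GRing.Theory Num.Theory.
Import numFieldNormedType.Exports.
Local Open Scope classical_set_scope.
Local Open Scope ring_scope.

(* A height configuration h = (h_0, ..., h_L) is represented as a seq int. *)

Definition flip (h : seq int) (x : nat) : seq int :=
  let hx := nth 0 h x in
  if (nth 0 h x.-1 == hx - 1) && (nth 0 h x.+1 == hx - 1) then set_nth 0 h x (hx - 2)
  else if (nth 0 h x.-1 == hx + 1) && (nth 0 h x.+1 == hx + 1) then set_nth 0 h x (hx + 2)
  else h.

(* genpow L b n a = (calL^n 1_{b})(a), where
   calL f(h) = 1/2 sum_{x=1}^{L-1} (f(h^{(x)}) - f(h)) is the generator. *)
Fixpoint genpow (R : realType) (L : nat) (b : seq int) (n : nat) (a : seq int) : R :=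
  match n with
  | 0 => (a == b)%:R
  | n'.+1 => 2^-1 * \sum_(1 <= x < L) (genpow R L b n' (flip a x) - genpow R L b n' a)
  end.

(* Transition probabilities p_t(a,b) = (e^{t calL})(a,b) = sum_n t^n/n! (calL^n)(a,b). *)
Definition trans (R : realType) (L : nat) (t : R) (a b : seq int) : R :=
  limn (series (fun n : nat => t ^+ n / (n`!)%:R * genpow R L b n a)).

(* Paths of a process with values in a discrete space are cadlag:
   right-continuous with left limits (locally constant on both sides). *)
Definition discrete_cadlag (R : realType) (f : R -> seq int) : Prop :=
  (forall t, 0 <= t -> exists2 delta : R, 0 < delta &
      forall s, t <= s -> s < t + delta -> f s = f t) /\
  (forall t, 0 < t -> exists2 delta : R, 0 < delta &
      exists c, forall s, t - delta < s -> s < t -> f s = c).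

Definition corner_flip_process (R : realType) (d : measure_display)
    (Om : measurableType d) (P : probability Om R) (L : nat) (h0 : seq int)
    (h : Om -> R -> seq int) : Prop :=
  (forall w, discrete_cadlag (h w)) /\
  (forall t s, 0 <= t -> measurable [set w | h w t = s]) /\
  (forall (k : nat) (ts : nat -> R) (ss : nat -> seq int),
      0 <= ts 0 -> (forall i, (i < k)%N -> ts i <= ts i.+1) ->
      P [set w | forall i, (i <= k)%N -> h w (ts i) = ss i] =
      (trans L (ts 0) h0 (ss 0) *
       \prod_(i < k) trans L (ts i.+1 - ts i) (ss i) (ss i.+1))%:E).

Definition init_height (R : realType) (phi0 : R -> R) (L : nat) (x : nat) : int :=
  let v := L%:R * phi0 (x%:R / L%:R) in
  if odd x then 2 * Num.floor ((v - 1) / 2) + 1 else 2 * Num.floor (v / 2).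

Definition init_profile (R : realType) (phi0 : R -> R) (L : nat) : seq int :=
  mkseq (init_height phi0 L) L.+1.

Definition lipschitz1_01 (R : realType) (f : R -> R) : Prop :=
  forall x y, 0 <= x <= 1 -> 0 <= y <= 1 -> `|f x - f y| <= `|x - y|.

Definition heat_solution (R : realType) (phi0 : R -> R) (phi : R -> R -> R) : Prop :=
  {within [set p : R * R | 0 <= p.1 <= 1 /\ 0 <= p.2],
     continuous (fun p : R * R => phi p.1 p.2)} /\
  (forall x, 0 <= x <= 1 -> phi x 0 = phi0 x) /\
  (forall t, 0 < t -> phi 0 t = 0 /\ phi 1 t = phi0 1) /\
  (forall x t, 0 < x < 1 -> 0 < t ->
     derivable (phi x) t 1 /\
     (forall y, 0 < y < 1 -> derivable (fun z => phi z t) y 1) /\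
     derivable (derive1 (fun z => phi z t)) x 1 /\
     derive1 (phi x) t = 2^-1 * derive1 (derive1 (fun z => phi z t)) x).

(* Main.v *)
Require Import Defs.
From HB Require Import structures.
From mathcomp Require Import all_boot all_order all_algebra.
From mathcomp Require Import all_classical all_reals all_analysis.
From mathcomp Require Import ring lra zify.
Import Order.TTheory GRing.Theory Num.Theory.
Import numFieldNormedType.Exports.
Local Open Scope classical_set_scope.
Local Open Scope ring_scope.

(* The generator acts on each coordinate h_x as half the discrete Laplacian, so
   the mean profile solves the discrete heat equation.  Let u be an exact
   solution of that equation with the same boundary values as h, and measure
   h - u by the squared H^{-1} norm.  Along the dynamics the drift of this
   energy is -|h - u|^2 plus the trace of the jump noise against the Green
   function, hence at most 2 L^2.  Over times of order L^2 the energy therefore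
   grows by O(L^4), whereas a deviation of order L at one site, spread out by
   the Lipschitz bound, costs energy of order L^5.  A maximal inequality for the
   chain observed on dyadic time grids, followed by right-continuity of the
   paths, makes the bound uniform in time.

   The solution u comes from approximating the initial profile, minus its
   linear part, by a finite sum of sines: sine modes diagonalize both the
   discrete and the continuous Laplacian, so the scaling limit of u is explicit,
   and the maximum principle compares that limit with phi. *)

(** * Height functions and the H^{-1} energy *)

(** The norm is dictated by scaling. In the squared L^2 norm the jump noise is of order L per unit
    time, so by time L^2 it may have contributed order L^3, no less than the cost of the deviations
    to be excluded, whose height and range are of order L. Passing to H^{-1} improves the ratio of
    the two by a factor L, and a bare supermartingale estimate suffices.

    The process is known only through its finite-dimensional laws, given by power series in the
    generator. They enter through a first-order Taylor bound on short intervals whose constant is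
    exponential in L; this is harmless because the mesh tends to 0 while L is fixed.

    The sine sum is chosen once, independently of L. Its initial error delta L costs only order
    delta^2 L^5, a small fraction of the energy threshold. *)

Definition laplacian {R : pzRingType} (f : nat -> R) (x : nat) : R :=
  f x.-1 + f x.+1 - 2 * f x.

Definition admissible (L : nat) (e : int) (a : seq int) : Prop :=
  [/\ size a = L.+1, nth 0 a 0 = 0, nth 0 a L = e &
      forall x, (x < L)%N -> `|nth 0 a x.+1 - nth 0 a x| = 1].

Definition walk (L : nat) (b : seq bool) : seq int :=
  mkseq (fun x => \sum_(i < x) (if nth false b i then 1 else -1)) L.+1.

(** An explicit duplicate-free list of the states: expectations under the chain become finite
    sums. *)
Definition heights (L : nat) (e : int) : seq (seq int) :=
  [seq a <- undup [seq walk L b | b : L.-tuple bool] | nth 0 a L == e].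

Lemma heights_uniq L e : uniq (heights L e).
Proof. by rewrite filter_uniq// undup_uniq. Qed.

Lemma mem_heights L e (a : seq int) : a \in heights L e <-> admissible L e a.
Proof.
rewrite mem_filter mem_undup; split.
  case/andP=> /eqP ae /mapP[b _ ab]; rewrite ab in ae *; split => //.
  - by rewrite size_mkseq.
  - by rewrite nth_mkseq// big_ord0.
  - move=> x xL; rewrite !nth_mkseq ?ltnS// 1?ltnW// big_ord_recr/= addrAC subrr add0r.
    by case: ifP.
case=> sa a0 aL st; rewrite aL eqxx/=; apply/mapP.
exists [tuple of mkseq (fun i => nth 0 a i.+1 - nth 0 a i == 1) L].
  by rewrite mem_enum.
apply: (@eq_from_nth _ 0); first by rewrite size_mkseq.
move=> i; rewrite sa ltnS => iL; rewrite nth_mkseq ?ltnS//.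
elim: i iL => [_|i IH iL]; first by rewrite big_ord0.
rewrite big_ord_recr/= -IH 1?ltnW//= nth_mkseq//.
have [h|h] : nth 0 a i.+1 - nth 0 a i = 1 \/ nth 0 a i.+1 - nth 0 a i = -1.
  by have := st i iL; lia.
- by rewrite -[LHS](subrK (nth 0 a i)) h/= addrC.
- by rewrite -[LHS](subrK (nth 0 a i)) h/= addrC.
Qed.

(** Neighbouring heights differ by 1, so the discrete Laplacian is -2, 2 or 0 exactly in the three
    cases of [flip]. This makes the drift of the heights linear. *)
Lemma nth_flip L e a x y : admissible L e a -> (0 < x < L)%N ->
  nth 0 (flip a x) y = nth 0 a y + (y == x)%:R * laplacian (nth 0 a) x.
Proof.
case=> sa a0 aL st /andP[x0 xL]; rewrite /flip /laplacian.
have h1 := st x xL; have := st x.-1; rewrite prednK// => /(_ (ltnW xL)) h2.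
case: ifP => [/andP[/eqP h3 /eqP h4]|h3].
  rewrite nth_set_nth/=; case: (y =P x) => [->|_]; rewrite ?h3 ?h4/= ?mul1r ?mul0r; lia.
case: ifP => [/andP[/eqP h4 /eqP h5]|h4].
  rewrite nth_set_nth/=; case: (y =P x) => [->|_]; rewrite ?h4 ?h5/= ?mul1r ?mul0r; lia.
suff -> : nth 0 a x.-1 + nth 0 a x.+1 - 2 * nth 0 a x = 0 by rewrite mulr0 addr0.
move: h3 h4; lia.
Qed.

Lemma admissible_flip L e a x : admissible L e a -> (0 < x < L)%N ->
  admissible L e (flip a x).
Proof.
move=> va xL; have nf := fun y => nth_flip L e a x y va xL.
case: (va) => sa a0 aL st; split.
- by rewrite /flip; do 2?[case: ifP => _]; rewrite ?size_set_nth sa//; lia.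
- by rewrite nf a0; case: eqP => [|_]; lia.
- by rewrite nf aL; case: eqP => [|_]; lia.
move=> y yL; rewrite !nf /laplacian.
have h1 := st y yL; case/andP: xL => x0 xL.
have h2 := st x xL; have := st x.-1; rewrite prednK// => /(_ (ltnW xL)) h3.
case: (y.+1 =P x) => [yx|_]; case: (y =P x) => [yx'|_].
- lia.
- by move: h2 h3; rewrite -yx/= => h2 h3; lia.
- by move: h2 h3; rewrite -yx'/= => h2 h3; lia.
- lia.
Qed.

Lemma admissible_lip L e a x y : admissible L e a -> (x <= L)%N -> (y <= L)%N ->
  `|nth 0 a x - nth 0 a y| <= `|x%:Z - y%:Z|.
Proof.
case=> sa a0 aL st; wlog xy : x y / (x <= y)%N => [H xL yL|].
  case: (leqP x y) => [xy|/ltnW xy]; first exact: H.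
  by rewrite distrC (distrC x%:Z); apply: H.
move=> _; rewrite -(subnKC xy); elim: (y - x)%N => [|k IH] h; first by rewrite addn0 !subrr.
have h1 := IH ltac:(lia); have := st (x + k)%N ltac:(lia); rewrite addnS; lia.
Qed.

Lemma admissible_bound L e a x : admissible L e a -> `|nth 0 a x| <= L%:Z.
Proof.
move=> va; case: (leqP x L) => [xL|xL]; last first.
  by rewrite nth_default// ?normr0//; case: va => ->.
by have := admissible_lip L e a x 0 va xL isT; case: va => _ -> _ _; lia.
Qed.

(** The kernel is the increment in [x] of the Green function min(x, y) - x y / L of the negative
    Laplacian with zero boundary values. *)
Definition potential {R : realType} (L : nat) (f : nat -> R) (x : nat) : R :=
  \sum_(1 <= y < L) ((x < y)%:R - y%:R / L%:R) * f y.

(* [potential L f] is the gradient of [(- laplacian)^-1 f] with zero boundary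
   values at [0] and [L] (see [potential_laplacian]), so this is the inner
   product of H^{-1}. *)
Definition hdot {R : realType} (L : nat) (f g : nat -> R) : R :=
  \sum_(x < L) potential L f x * potential L g x.

Lemma eq_potential {R : realType} L (f g : nat -> R) x :
  (forall y, (0 < y < L)%N -> f y = g y) -> potential L f x = potential L g x.
Proof. by move=> fg; apply: eq_big_nat => y yL; rewrite fg. Qed.

Lemma eq_hdot {R : realType} L (f g f' g' : nat -> R) :
  (forall y, (0 < y < L)%N -> f y = f' y) ->
  (forall y, (0 < y < L)%N -> g y = g' y) ->
  hdot L f g = hdot L f' g'.
Proof.
move=> ff gg; apply: eq_bigr => x _.
by rewrite (eq_potential _ _ _ _ ff) (eq_potential _ _ _ _ gg).
Qed.

Lemma potentialD {R : realType} L (f g : nat -> R) x :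
  potential L (fun y => f y + g y) x = potential L f x + potential L g x.
Proof. by rewrite -big_split; apply: eq_bigr => y _; rewrite mulrDr. Qed.

Lemma potentialZ {R : realType} L c (f : nat -> R) x :
  potential L (fun y => c * f y) x = c * potential L f x.
Proof. by rewrite /potential big_distrr/=; apply: eq_bigr => y _; rewrite mulrCA. Qed.

Lemma hdotC {R : realType} L (f g : nat -> R) : hdot L f g = hdot L g f.
Proof. by apply: eq_bigr => x _; rewrite mulrC. Qed.

Lemma hdotDr {R : realType} L (f g h : nat -> R) :
  hdot L f (fun y => g y + h y) = hdot L f g + hdot L f h.
Proof. by rewrite -big_split; apply: eq_bigr => x _; rewrite potentialD mulrDr. Qed.

Lemma hdotZr {R : realType} L c (f g : nat -> R) :
  hdot L f (fun y => c * g y) = c * hdot L f g.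
Proof. by rewrite /hdot big_distrr/=; apply: eq_bigr => x _; rewrite potentialZ mulrCA. Qed.

Lemma hdot_ge0 {R : realType} L (f : nat -> R) : 0 <= hdot L f f.
Proof. by apply: sumr_ge0 => x _; rewrite -expr2 sqr_ge0. Qed.

Lemma hdotDD {R : realType} L (f g : nat -> R) :
  hdot L (fun y => f y + g y) (fun y => f y + g y) =
  hdot L f f + 2 * hdot L f g + hdot L g g.
Proof.
rewrite hdotDr !(hdotC L (fun y => f y + g y)) !hdotDr (hdotC L g f); ring.
Qed.

Lemma potential_bound {R : realType} L (f : nat -> R) (M : R) x :
  (forall y, (0 < y < L)%N -> `|f y| <= M) -> 0 <= M ->
  `|potential L f x| <= L%:R * M.
Proof.
move=> fM M0; apply: le_trans (ler_norm_sum _ _ _) _.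
apply: (@le_trans _ _ (\sum_(1 <= y < L) M)); last first.
  rewrite sumr_const_nat -[leLHS]mulr_natl ler_wpM2r// ler_nat; lia.
apply: ler_sum_nat => y yL.
rewrite normrM -[leRHS]mul1r ler_pM// ?fM//.
have L0 : 0 < L%:R :> R by rewrite ltr0n; lia.
have y1 : y%:R / L%:R <= 1 :> R by rewrite ler_pdivrMr// mul1r ler_nat; lia.
have y0 : 0 <= y%:R / L%:R :> R by rewrite divr_ge0.
by case: (x < y)%N; rewrite ler_norml/=; lra.
Qed.

Lemma hdot_bound {R : realType} L (f g : nat -> R) (M M' : R) :
  (forall y, (0 < y < L)%N -> `|f y| <= M) -> 0 <= M ->
  (forall y, (0 < y < L)%N -> `|g y| <= M') -> 0 <= M' ->
  `|hdot L f g| <= L%:R ^+ 3 * M * M'.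
Proof.
move=> fM M0 gM M0'; apply: le_trans (ler_norm_sum _ _ _) _.
apply: (@le_trans _ _ (\sum_(x < L) (L%:R * M) * (L%:R * M'))); last first.
  by rewrite sumr_const card_ord -mulr_natl le_eqVlt; apply/orP; left; apply/eqP; ring.
by apply: ler_sum => x _; rewrite normrM ler_pM// potential_bound.
Qed.

Lemma potential_laplacian {R : realType} L (f : nat -> R) x : (x < L)%N ->
  f 0%N = 0 -> f L = 0 -> potential L (laplacian f) x = f x - f x.+1.
Proof.
case: L => // m xm f0 fL.
(* Closed form of the partial sums: the indicator part telescopes, the part with weight [y] is an
   Abel summation. *)
have key k : \sum_(1 <= y < k.+1) ((x < y)%:R - y%:R / m.+1%:R) * laplacian f y =
   (x <= k)%:R * (f k.+1 - f k - (f x.+1 - f x))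
   - (k%:R * (f k.+1 - f k) - f k) / m.+1%:R :> R.
  elim: k => [|k IH].
    rewrite big_geq// f0 leqn0; case: eqP => [->|_]; rewrite ?f0/=; ring.
  rewrite big_nat_recr//= IH /laplacian/= -(@natr1 _ k).
  have -> : (x <= k.+1)%N = (x == k.+1) || (x <= k)%N by rewrite leq_eqVlt ltnS.
  rewrite ltnS.
  case: (x =P k.+1) => [->|_]; first by rewrite ltnn /=; ring.
  by rewrite /=; case: (x <= k)%N; ring.
rewrite /potential key -ltnS xm fL.
have : m.+1%:R != 0 :> R by rewrite pnatr_eq0.
by rewrite -natr1 /= => m0; field.
Qed.

(** Summation by parts, since [potential] drops by [f x] across [x]. This is the duality between
    H^{-1} and H^1. *)
Lemma potential_pair {R : realType} L (f g : nat -> R) : (0 < L)%N ->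
  g 0%N = 0 -> g L = 0 ->
  \sum_(x < L) potential L f x * (g x.+1 - g x) = \sum_(1 <= x < L) f x * g x.
Proof.
case: L => // m _ g0 gL.
have pE x : (0 < x < m.+1)%N -> potential m.+1 f x.-1 - potential m.+1 f x = f x.
  move=> xm; rewrite -sumrB.
  rewrite (bigD1_seq x) ?mem_index_iota ?iota_uniq//=.
  rewrite big1 ?addr0; last first.
    move=> y yx; have -> : (x.-1 < y)%N = (x < y)%N by move/eqP: yx; lia.
    by rewrite subrr.
  have -> : (x.-1 < x)%N by lia.
  rewrite ltnn/=; ring.
have key k : (k <= m)%N -> \sum_(x < k.+1) potential m.+1 f x * (g x.+1 - g x) =
    potential m.+1 f k * g k.+1 + \sum_(1 <= x < k.+1) f x * g x.
  elim: k => [_|k IH km]; first by rewrite big_ord1 big_geq// g0; ring.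
  rewrite big_ord_recr/= IH; last by lia.
  rewrite [in RHS]big_nat_recr//= -(pE k.+1); last by lia.
  by rewrite /=; ring.
by rewrite key// gL mulr0 add0r.
Qed.

(** The value is exactly minus the sum of the squares of [f]: this is the dissipation of the
    energy. *)
Lemma hdot_laplacian_le0 {R : realType} L (f : nat -> R) : (0 < L)%N ->
  f 0%N = 0 -> f L = 0 -> hdot L f (laplacian f) <= 0.
Proof.
move=> L0 f0 fL; rewrite /hdot.
under eq_bigr => x _ do rewrite potential_laplacian// -opprB mulrN.
rewrite sumrN potential_pair// oppr_le0; apply: sumr_ge0 => x _.
by rewrite -expr2 sqr_ge0.
Qed.

(** Cauchy-Schwarz for [potential_pair], with the gradient of [g] bounded by 1. *)
Lemma hdot_lower {R : realType} L (f g : nat -> R) : (0 < L)%N ->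
  g 0%N = 0 -> g L = 0 -> (forall x, (x < L)%N -> `|g x.+1 - g x| <= 1) ->
  (\sum_(1 <= x < L) f x * g x) ^+ 2 <= L%:R * hdot L f f.
Proof.
move=> L0 g0 gL g1; rewrite -potential_pair//.
set S := \sum_(x < L) _.
have : 0 <= \sum_(x < L) (L%:R * potential L f x - S * (g x.+1 - g x)) ^+ 2.
  by apply: sumr_ge0 => x _; rewrite sqr_ge0.
have -> : \sum_(x < L) (L%:R * potential L f x - S * (g x.+1 - g x)) ^+ 2 =
   L%:R ^+ 2 * hdot L f f - 2 * L%:R * S ^+ 2 + S ^+ 2 * \sum_(x < L) (g x.+1 - g x) ^+ 2.
  rewrite (eq_bigr (fun x : 'I_L => L%:R ^+ 2 * (potential L f x * potential L f x)
    + - (2 * L%:R * S) * (potential L f x * (g x.+1 - g x))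
    + S ^+ 2 * (g x.+1 - g x) ^+ 2)); last by move=> x _; ring.
  by rewrite !big_split/= -!big_distrr/= -/S -/(hdot L f f); ring.
have : S ^+ 2 * \sum_(x < L) (g x.+1 - g x) ^+ 2 <= S ^+ 2 * L%:R.
  rewrite ler_wpM2l ?sqr_ge0// -[X in _ <= X%:R]card_ord -sumr_const.
  by apply: ler_sum => x _; rewrite -real_normK ?num_real// expr_le1// g1.
have L0' : 0 < L%:R :> R by rewrite ltr0n.
move=> h1 h2; have h3 : L%:R * (S ^+ 2) <= L%:R * (L%:R * hdot L f f) by lra.
by rewrite ler_pM2l in h3.
Qed.

(** Apply [hdot_lower] to a tent of slope 1 around [x]; half of the tent already has area w^2 /
    2. *)
Lemma hdot_bump {R : realType} L (f : nat -> R) x w (c : R) : (0 < L)%N -> 0 < c ->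
  f 0%N = 0 -> f L = 0 -> (x <= L)%N ->
  (forall y, (y <= L)%N -> (x < y + w)%N -> (y < x + w)%N -> c <= f y) ->
  (c * w%:R ^+ 2 / 2) ^+ 2 <= L%:R * hdot L f f.
Proof.
move=> L0 c0 f0 fL xL fc.
(* Truncated subtraction writes |x - y| as a sum of two differences, one of them 0, and cuts the
   tent off at height 0. *)
pose g (y : nat) : R := (w - ((y - x) + (x - y)))%N%:R.
(* The tent fits between the endpoints: [f] vanishes there, while within distance [w] of [x] it is
   at least [c > 0]. *)
have wx : (w <= x)%N.
  rewrite leqNgt; apply/negP => wx; have := fc 0%N isT wx ltac:(lia).
  by rewrite f0 leNgt c0.
have wxL : (x + w <= L)%N.
  rewrite leqNgt; apply/negP => wxL; have := fc L (leqnn _) ltac:(lia) wxL.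
  by rewrite fL leNgt c0.
have g0 : g 0%N = 0 by rewrite /g (_ : (_ - _)%N = 0%N)//; lia.
have gL : g L = 0 by rewrite /g (_ : (_ - _)%N = 0%N)//; lia.
have g1 y : (y < L)%N -> `|g y.+1 - g y| <= 1.
  move=> _; rewrite /g.
  set a := (w - _)%N; set b := (w - _)%N.
  have : a = b \/ a = b.+1 \/ b = a.+1 by lia.
  case=> [->|[->|->]]; rewrite ?subrr ?normr0//.
    by rewrite -natr1 [_ + 1]addrC addrK normr1.
  by rewrite -natr1 opprD addrA subrr sub0r normrN normr1.
apply: le_trans (hdot_lower L f g L0 g0 gL g1).
rewrite -[leLHS]real_normK ?num_real// -[leRHS]real_normK ?num_real//.
rewrite lerXn2r// ?nnegrE//.
rewrite ger0_norm; last by rewrite divr_ge0// mulr_ge0// ?sqr_ge0// ltW.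
apply: le_trans (ler_norm _).
have fg y : (0 < y < L)%N -> 0 <= f y * g y /\ c * g y <= f y * g y.
  move=> yL; rewrite /g.
  case: (posnP (w - (y - x + (x - y)))) => [->|h]; first by rewrite !mulr0.
  have fy : c <= f y by apply: fc; lia.
  split; first by rewrite mulr_ge0//; lra.
  by rewrite ler_wpM2r.
have [->|w0] := posnP w.
  rewrite expr0n/= mulr0 mul0r big_nat; apply: sumr_ge0 => y yL.
  by case: (fg y yL).
(* Only the right half of the tent is kept, with sum w + ... + 1 = w (w + 1) / 2; the other terms
   are nonnegative. *)
rewrite (@big_cat_nat _ _ _ x)/=; [|lia|lia].
rewrite (@big_cat_nat _ _ _ (x + w) x)/=; [|lia|lia].
rewrite -[leLHS]add0r -[X in _ + X <= _]addr0; apply: lerD.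
  by rewrite big_nat; apply: sumr_ge0 => y yL; case: (fg y ltac:(lia)).
apply: lerD; last first.
  by rewrite big_nat; apply: sumr_ge0 => y yL; case: (fg y ltac:(lia)).
apply: (@le_trans _ _ (\sum_(x <= y < x + w) c * g y)); last first.
  by apply: ler_sum_nat => y yL; case: (fg y ltac:(lia)).
rewrite -big_distrr/= -mulrA ler_pM2l// -{1}[x]add0n big_addn addKn.
rewrite big_mkord (eq_bigr (fun i : 'I_w => (w - i)%N%:R)); last first.
  by move=> i _; rewrite /g; congr (_ %:R); lia.
rewrite -natr_sum.
have -> : (\sum_(i < w) (w - i) = \sum_(i < w) i.+1)%N.
  rewrite (reindex_inj rev_ord_inj)/=; apply: eq_bigr => i _.
  by have := ltn_ord i; lia.
have -> : (\sum_(i < w) i.+1 = 'C(w.+1, 2))%N.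
  rewrite -bin2_sum big_ltn// add0n -[1%N]add0n big_addn subn1/= big_mkord.
  by apply: eq_bigr => i _; rewrite addn1.
rewrite ler_pdivrMr// -natrX -natrM ler_nat -mulnn.
have := mul_bin_diag w.+1 1; rewrite /= bin1; lia.
Qed.

(** * Short-time expansion of the transition probabilities *)

Definition generator {R : realType} (L : nat) (g : seq int -> R) (a : seq int) : R :=
  2^-1 * \sum_(1 <= x < L) (g (flip a x) - g a).

Lemma big_seq_pick {R : realType} {I : eqType} (s : seq I) (g : I -> R) a :
  uniq s -> a \in s -> \sum_(b <- s) (a == b)%:R * g b = g a.
Proof.
move=> us sa; rewrite (bigD1_seq a)//= eqxx mul1r big1 ?addr0// => b.
by rewrite eq_sym => /negbTE ->; rewrite mul0r.
Qed.

(** [genpow] holds the matrix entries of the powers of the generator; flips preserve [heights], so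
    the matrix acts on functions on that list. *)
Lemma sum_genpow {R : realType} L e (g : seq int -> R) n a : admissible L e a ->
  \sum_(b <- heights L e) genpow R L b n a * g b = iter n (generator L) g a.
Proof.
elim: n a => [|n IH] a va /=.
  by rewrite big_seq_pick ?heights_uniq//; apply/mem_heights.
rewrite /generator; under eq_bigr do rewrite -mulrA mulr_suml.
rewrite -mulr_sumr exchange_big/=; congr (_ * _).
apply: eq_big_nat => x xL; rewrite -!IH//; last exact: admissible_flip.
by rewrite -sumrB; apply: eq_bigr => b _; rewrite mulrBl.
Qed.

Lemma iter_generator_bound {R : realType} L e (g : seq int -> R) (B : R) n a :
  (forall b, admissible L e b -> `|g b| <= B) -> admissible L e a ->
  `|iter n (generator L) g a| <= L%:R ^+ n * B.
Proof.
move=> gB; have B0 a' : admissible L e a' -> 0 <= B.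
  by move=> va; apply: le_trans (gB _ va).
elim: n a => [|n IH] a va /=; first by rewrite expr0 mul1r gB.
rewrite /generator normrM ger0_norm ?invr_ge0// -ler_pdivlMl ?invr_gt0// invrK.
apply: le_trans (ler_norm_sum _ _ _) _.
apply: (@le_trans _ _ (\sum_(1 <= x < L) 2 * (L%:R ^+ n * B))).
  apply: ler_sum_nat => x xL; apply: le_trans (ler_normB _ _) _.
  have := IH _ va; have := IH _ (admissible_flip _ _ _ _ va xL); lra.
rewrite sumr_const_nat -[leLHS]mulr_natl exprS mulrCA ler_wpM2l// -mulrA.
rewrite ler_wpM2r ?ler_nat ?leq_subr// mulr_ge0 ?exprn_ge0//; exact: B0 va.
Qed.

Lemma genpow_bound {R : realType} L e b n a : admissible L e a ->
  `|genpow R L b n a| <= L%:R ^+ n.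
Proof.
move=> va; have -> : genpow R L b n a = iter n (generator L) (fun a => (a == b)%:R) a.
  by elim: n a {va} => //= n IH a; rewrite IH; congr (_ * _); apply: eq_bigr => x _; rewrite IH.
rewrite -[leRHS]mulr1; apply: iter_generator_bound va => a' _.
by case: (a' == b); rewrite ?normr1 ?normr0.
Qed.

Lemma exp_dominated_cvg {R : realType} (u : nat -> R) (B K t : R) :
  0 <= t -> (forall n, `|u n| <= K ^+ n * B) -> 0 <= K -> 0 <= B ->
  cvgn (series (fun n => t ^+ n / n`!%:R * u n)).
Proof.
move=> t0 uB K0 B0; apply: normed_cvg; rewrite /normed_series_of/=.
have cv := is_cvg_seriesZ (k := B) (is_cvg_series_exp_coeff (t * K)).
apply: (series_le_cvg _ _ _ cv).
- by move=> n.
- by move=> n; rewrite /= /exp_coeff/= /GRing.scale/= !mulr_ge0// ?invr_ge0 ?exprn_ge0// mulr_ge0.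
- move=> n; rewrite /= /exp_coeff/= /GRing.scale/= normrM ger0_norm; last first.
    by rewrite divr_ge0// exprn_ge0.
  have -> : B *: ((t * K) ^+ n / n`!%:R) = t ^+ n / n`!%:R * (K ^+ n * B).
    by rewrite /GRing.scale/= exprMn; ring.
  by rewrite ler_wpM2l// divr_ge0// exprn_ge0.
Qed.

(** For t <= 1 each term with n >= 2 carries t^n <= t^2, and what remains is dominated by the
    exponential series of [K]. *)
Lemma exp_dominated_taylor {R : realType} (u : nat -> R) (B K t : R) :
  0 <= t <= 1 -> (forall n, `|u n| <= K ^+ n * B) -> 0 <= K -> 0 <= B ->
  `|limn (series (fun n => t ^+ n / n`!%:R * u n)) - (u 0%N + t * u 1%N)|
    <= t ^+ 2 * (B * expR K).
Proof.
move=> /andP[t0 t1] uB K0 B0.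
have cu := exp_dominated_cvg _ _ _ _ t0 uB K0 B0.
set w := fun n => _ in cu *.
have key N : (2 <= N)%N -> `|series w N - (u 0%N + t * u 1%N)| <= t ^+ 2 * (B * expR K).
  move=> N2; rewrite /series/= (@big_cat_nat _ _ _ 2)//=.
  rewrite big_nat_recr// big_nat1/= /w expr0 expr1 fact0 factS fact0 muln1 !divr1 mul1r.
  rewrite addrC addrK; apply: le_trans (ler_norm_sum _ _ _) _.
  apply: (@le_trans _ _ (\sum_(2 <= i < N) t ^+ 2 * B * exp_coeff K i)).
    apply: ler_sum_nat => i /andP[i2 _]; rewrite normrM ger0_norm; last first.
      by rewrite divr_ge0// exprn_ge0.
    rewrite /exp_coeff/=.
    have t2 : t ^+ i <= t ^+ 2.
      by rewrite -(subnK i2) exprD ler_piMl ?exprn_ge0 ?exprn_ile1.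
    have -> : t ^+ 2 * B * (K ^+ i / i`!%:R) = (t ^+ 2 / i`!%:R) * (K ^+ i * B) by ring.
    apply: ler_pM => //; first by rewrite divr_ge0// exprn_ge0.
    by rewrite ler_wpM2r// invr_ge0.
  rewrite -big_distrr/= -mulrA ler_wpM2l ?sqr_ge0// ler_wpM2l//.
  apply: (@le_trans _ _ (series (exp_coeff K) N)).
    rewrite /series/= [leRHS](@big_cat_nat _ _ _ 2)//= lerDr.
    by apply: sumr_ge0 => i _; apply: exp_coeff_ge0.
  apply: nondecreasing_cvgn_le; last exact: is_cvg_series_exp_coeff.
  by apply/nondecreasing_seqP => n; rewrite /series/= big_nat_recr//= lerDl exp_coeff_ge0.
rewrite ler_distl; apply/andP; split.
  apply: limr_ge => //; near=> n.
  have /key : (2 <= n)%N by near: n; exists 2%N.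
  by rewrite ler_distl => /andP[].
apply: limr_le => //; near=> n.
have /key : (2 <= n)%N by near: n; exists 2%N.
by rewrite ler_distl => /andP[].
Unshelve. all: by end_near.
Qed.

Lemma cvgn_sum_seq {R : realType} {I : eqType} (s : seq I) (u : I -> nat -> R) (l : I -> R) :
  (forall i, i \in s -> u i n @[n --> \oo] --> l i) ->
  (\sum_(i <- s) u i n) @[n --> \oo] --> \sum_(i <- s) l i.
Proof.
elim: s => [|i s IH] h.
  by under eq_fun do rewrite big_nil; rewrite big_nil; exact: cvg_cst.
under eq_fun do rewrite big_cons; rewrite big_cons; apply: cvgD.
  by apply: h; rewrite mem_head.
by apply: IH => j js; apply: h; rewrite inE js orbT.
Qed.

(** Exchanging the finite sum over states with the series turns the left side into the exponential
    series of the generator applied to [g]. At [t = 0] the expansion is exact, which identifies the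
    law at time 0. *)
Lemma trans_taylor {R : realType} L e (g : seq int -> R) (B t : R) a :
  admissible L e a -> (forall b, admissible L e b -> `|g b| <= B) -> 0 <= t <= 1 ->
  `|\sum_(b <- heights L e) trans L t a b * g b - (g a + t * generator L g a)|
    <= t ^+ 2 * (B * expR L%:R).
Proof.
move=> va gB t01; have B0 : 0 <= B by apply: le_trans (gB _ va).
pose u n := iter n (generator L) g a.
have uB n : `|u n| <= L%:R ^+ n * B by exact: iter_generator_bound gB va.
suff -> : \sum_(b <- heights L e) trans L t a b * g b =
    limn (series (fun n => t ^+ n / n`!%:R * u n)).
  exact: exp_dominated_taylor.
apply/esym/cvg_lim => //.
have -> : series (fun n => t ^+ n / n`!%:R * u n) = fun N =>
    \sum_(b <- heights L e) series (fun n => t ^+ n / n`!%:R * genpow R L b n a) N * g b.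
  apply/funext => N; rewrite /series/=; under [RHS]eq_bigr do rewrite mulr_suml.
  rewrite exchange_big/=; apply: eq_bigr => n _.
  rewrite /u -(sum_genpow _ _ _ _ _ va) mulr_sumr.
  by apply: eq_bigr => b _; rewrite mulrA.
apply: cvgn_sum_seq => b _; apply: cvgM; last exact: cvg_cst.
apply: (@exp_dominated_cvg _ _ 1 L%:R); rewrite ?ler01//; first by case/andP: t01.
by move=> n; rewrite mulr1; exact: genpow_bound va.
Qed.

(** * Drift of the energy *)

Definition deviation {R : realType} (u : nat -> R) (a : seq int) (y : nat) : R :=
  (nth 0 a y)%:~R - u y.

Definition energy {R : realType} (L : nat) (u : nat -> R) (a : seq int) : R :=
  hdot L (deviation u a) (deviation u a).

Lemma potential_delta {R : realType} L x z : (0 < x < L)%N ->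
  potential L (fun y => (y == x)%:R) z = (z < x)%:R - x%:R / L%:R :> R.
Proof.
move=> xL; rewrite /potential (bigD1_seq x) ?mem_index_iota ?iota_uniq//=.
rewrite eqxx mulr1 big1 ?addr0// => y /negbTE ->; by rewrite mulr0.
Qed.

(** The left side is the diagonal x (L - x) / L of the Green function: the H^{-1} cost of a unit
    jump at [x]. *)
Lemma hdot_delta_le {R : realType} L x : (0 < x < L)%N ->
  hdot L (fun y => (y == x)%:R) (fun y => (y == x)%:R) <= L%:R :> R.
Proof.
move=> xL; rewrite -[X in _ <= X%:R]card_ord -sumr_const; apply: ler_sum => z _.
rewrite !potential_delta//.
have L0 : 0 < L%:R :> R by rewrite ltr0n; lia.
have y1 : x%:R / L%:R <= 1 :> R by rewrite ler_pdivrMr// mul1r ler_nat; lia.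
have y0 : 0 <= x%:R / L%:R :> R by rewrite divr_ge0.
rewrite -expr2 -real_normK ?num_real// expr_le1//.
by case: (z < x)%N; rewrite ler_norml/=; lra.
Qed.

Lemma sum_hdot_delta {R : realType} L (f j : nat -> R) :
  \sum_(1 <= x < L) j x * hdot L f (fun y => (y == x)%:R) = hdot L f j.
Proof.
rewrite /hdot; under eq_bigr do rewrite mulr_sumr.
rewrite exchange_big/=; apply: eq_bigr => z _.
rewrite [potential L j z]/potential mulr_sumr; apply: eq_big_nat => x xL.
rewrite potential_delta//; ring.
Qed.

(** A flip at [x] adds [j x] times a delta to the deviation. The cross terms sum to the pairing with
    the Laplacian; each square is at most 4 L, and half the sum over fewer than L sites gives 2
    L^2. *)
Lemma generator_energy {R : realType} L e (u : nat -> R) a : admissible L e a ->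
  generator L (energy L u) a <=
  hdot L (deviation u a) (laplacian (fun y => (nth 0 a y)%:~R)) + 2 * L%:R ^+ 2.
Proof.
move=> va; set f := deviation u a; pose j : nat -> R := laplacian (fun y => (nth 0 a y)%:~R).
have jE x : j x = (laplacian (nth 0 a) x)%:~R.
  by rewrite /j /laplacian !(intrD, rmorphN, rmorphM)/=.
have j2 x : (0 < x < L)%N -> j x ^+ 2 <= 4.
  move=> xL; have : `|laplacian (nth 0 a) x| <= 2.
    case: (va) => _ _ _ st; have h1 := st x ltac:(lia).
    have := st x.-1 ltac:(lia); rewrite prednK; last by lia.
    rewrite /laplacian; lia.
  rewrite -real_normK ?num_real// jE -intr_norm => h.
  have -> : 4 = 2 ^+ 2 :> R by ring.
  by rewrite lerXn2r ?nnegrE//; rewrite -[2]/(2%:~R) ler_int.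
rewrite /generator.
rewrite (@le_trans _ _ (2^-1 * \sum_(1 <= x < L) (2 * (j x * hdot L f (fun y => (y == x)%:R)) + 4 * L%:R)))//.
  rewrite ler_wpM2l ?invr_ge0//; apply: ler_sum_nat => x xL.
  have -> : energy L u (flip a x) =
      hdot L (fun y => f y + j x * (y == x)%:R) (fun y => f y + j x * (y == x)%:R).
    have E y : deviation u (flip a x) y = f y + j x * (y == x)%:R.
      by rewrite /f /deviation (nth_flip _ _ _ _ _ va xL) intrD intrM -jE pmulrn; ring.
    by apply: eq_hdot => y _; apply: E.
  have hD : hdot L (fun y => j x * (y == x)%:R) (fun y => j x * (y == x)%:R) <= 4 * L%:R.
    rewrite hdotZr hdotC hdotZr mulrA -expr2.
    by apply: ler_pM; rewrite ?sqr_ge0 ?hdot_ge0 ?j2 ?hdot_delta_le.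
  rewrite hdotDD hdotZr; move: hD; rewrite -/(energy L u a); lra.
rewrite big_split/= -mulr_sumr sum_hdot_delta mulrDr mulrA mulVf ?pnatr_eq0// mul1r lerD2l.
rewrite sumr_const_nat -[X in _ * X]mulr_natl.
have : (L - 1)%N%:R <= L%:R :> R by rewrite ler_nat leq_subr.
have : 0 <= L%:R :> R by [].
rewrite expr2; nra.
Qed.

Lemma deviation_bound {R : realType} L e (u : nat -> R) (U : R) a y :
  admissible L e a -> `|u y| <= U -> `|deviation u a y| <= L%:R + U.
Proof.
move=> va uU; apply: le_trans (ler_normB _ _) _; apply: lerD => //.
by rewrite -intr_norm -[L%:R]/(L%:Z%:~R) ler_int (admissible_bound _ _ _ _ va).
Qed.

(** The first term bounds the Euler defect paired with the deviation, the second the Taylor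
    remainder of the energy minus [lam]. What matters is that it does not depend on the time
    step. *)
Definition step_constant {R : realType} (L : nat) (U C lam : R) : R :=
  2 * (L%:R ^+ 3 * (L%:R + U) * C) + (L%:R ^+ 3 * (L%:R + U) * (L%:R + U) + lam) * expR L%:R.

(* [u'] is an implicit Euler step from [u], up to an error [C * t ^+ 2]. *)
Lemma energy_step {R : realType} L e (u u' : nat -> R) (U C lam t : R) a :
  (0 < L)%N -> admissible L e a -> u' 0%N = 0 -> u' L = e%:~R ->
  0 <= t <= 1 -> 0 <= lam -> 0 <= U -> 0 <= C ->
  (forall y, (0 < y < L)%N -> `|u' y| <= U) ->
  (forall y, (0 < y < L)%N -> `|u' y - u y - t / 2 * laplacian u' y| <= C * t ^+ 2) ->
  \sum_(b <- heights L e) trans L t a b * (energy L u' b - lam) <=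
  energy L u a - lam + t * (2 * L%:R ^+ 2) + t ^+ 2 * step_constant L U C lam.
Proof.
move=> L0 va u0 uL t01 lam0 U0 C0 uU uC.
have LU : 0 <= L%:R + U by rewrite addr_ge0.
have EB b : admissible L e b ->
    `|energy L u' b - lam| <= L%:R ^+ 3 * (L%:R + U) * (L%:R + U) + lam.
  move=> vb; apply: le_trans (ler_normB _ _) _; rewrite (ger0_norm lam0) lerD2r.
  by apply: hdot_bound => // y yL; apply: deviation_bound vb _; apply: uU.
have := trans_taylor _ _ _ _ _ _ va EB t01; rewrite ler_distl => /andP[_].
set S := \sum_(b <- _) _ => hS.
(* The generator kills constants, so the shift by [lam] does not change the drift. *)
have gE : generator L (fun b => energy L u' b - lam) a = generator L (energy L u') a.
  by congr (_ * _); apply: eq_bigr => x _; ring.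
have := generator_energy _ _ u' _ va; rewrite gE in hS.
set f := deviation u' a; set j := laplacian _ => hG.
pose r y := u' y - u y - t / 2 * laplacian u' y.
(* Expanding around [u'] and dropping the square of [u' - u] errs in the favourable direction. The
   Laplacian needed against the drift is then the one at the new time, hence the implicit scheme. *)
have hE : energy L u' a + 2 * hdot L f (fun y => u' y - u y) <= energy L u a.
  have -> : energy L u a = hdot L (fun y => f y + (u' y - u y)) (fun y => f y + (u' y - u y)).
    by apply: eq_hdot => y _; rewrite /f /deviation; ring.
  by rewrite hdotDD lerDl hdot_ge0.
have hd : hdot L f (fun y => u' y - u y) = t / 2 * hdot L f (laplacian u') + hdot L f r.
  by rewrite -hdotZr -hdotDr; apply: eq_hdot => // y _; rewrite /r; ring.
have hr : `|hdot L f r| <= L%:R ^+ 3 * (L%:R + U) * (C * t ^+ 2).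
  apply: hdot_bound => //; first by move=> y yL; apply: deviation_bound va _; apply: uU.
  by rewrite mulr_ge0// sqr_ge0.
(* The two drifts combine to [hdot L f (laplacian f)], where [f] vanishes at both ends. *)
have hl : hdot L f j - hdot L f (laplacian u') <= 0.
  rewrite (_ : _ - _ = hdot L f (laplacian f)); last first.
    rewrite -[hdot L f (laplacian u')]opprK -[- hdot _ _ _]mulN1r -hdotZr opprK.
    rewrite (_ : hdot L f j = hdot L f (fun y => laplacian f y + 1 * laplacian u' y)).
      by rewrite hdotDr hdotZr hdotZr; ring.
    by apply: eq_hdot => // y _; rewrite /j /f /laplacian /deviation; ring.
  apply: hdot_laplacian_le0 => //; rewrite /f /deviation.
    by rewrite u0; case: va => _ -> _ _; rewrite subr0.
  by rewrite uL; case: va => _ _ -> _; rewrite subrr.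
case/andP: t01 => t0 t1; rewrite hd in hE.
have hG' := ler_wpM2l t0 hG; have hl' := mulr_ge0_le0 t0 hl.
move: hr; rewrite ler_norml => /andP[hr _].
rewrite /step_constant; set e1 := expR _ in hS *.
move: hS hE hG' hl' hr; set A := L%:R ^+ 3; set B := hdot L f r.
move=> hS hE hG' hl' hr; lra.
Qed.

(** * Maximal inequality *)

Lemma measurable_mem_fibers {d : measure_display} {Om : measurableType d} {T : eqType}
    (Y : Om -> T) (s : seq T) : (forall y, measurable [set w | Y w = y]) ->
  measurable [set w | Y w \in s].
Proof.
move=> mY; elim: s => [|z s IH].
  by rewrite (_ : [set _ | _] = set0)//; apply/seteqP; split.
rewrite (_ : [set w | _] = [set w | Y w = z] `|` [set w | Y w \in s]).
  by apply: measurableU.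
apply/seteqP; split=> w /=; rewrite inE; first by case/orP=> [/eqP|]; [left|right].
by case=> [->|->]; rewrite ?eqxx ?orbT.
Qed.

Lemma fine_probability_split {R : realType} {d : measure_display} {Om : measurableType d}
    (P : probability Om R) {T : eqType} (X : set Om) (Y : Om -> T) (s : seq T) :
  uniq s -> measurable X -> (forall y, measurable [set w | Y w = y]) ->
  fine (P (X `&` [set w | Y w \in s])) =
  \sum_(y <- s) fine (P (X `&` [set w | Y w = y])).
Proof.
move=> us mX mY; elim: s us => [_|y s IH /andP[ys us]].
  by rewrite big_nil (_ : _ `&` _ = set0) ?measure0//; apply/seteqP; split=> w//= [].
have mS : measurable [set w | Y w \in s] by exact: measurable_mem_fibers.
rewrite big_cons -IH// -fineD; last 2 first.
- by apply: fin_num_measure; exact: measurableI.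
- by apply: fin_num_measure; exact: measurableI.
congr fine; rewrite -measureU; last first.
- apply/seteqP; split=> w //= [[_ wy] [_]]; by rewrite wy (negbTE ys).
- exact: measurableI.
- exact: measurableI.
congr (P _); rewrite -setIUr; congr (_ `&` _); apply/seteqP; split=> w /=; rewrite inE.
  by case/orP=> [/eqP|]; [left|right].
by case=> [->|->]; rewrite ?eqxx ?orbT.
Qed.

Lemma measurable_forall_nat {d : measure_display} {Om : measurableType d}
    (D : nat -> bool) (A : nat -> Om -> Prop) :
  (forall i, D i -> measurable [set w | A i w]) -> measurable [set w | forall i, D i -> A i w].
Proof.
move=> mA; rewrite (_ : [set w | _] = \bigcap_(i in [set i | D i]) [set w | A i w])//.
exact: bigcap_measurableType.
Qed.

(** Interpolates between the finite-dimensional events ([j = 0]) and the event of having stayed in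
    the sets [G]. *)
Definition cylinder {R : realType} {Om : Type} (h : Om -> R -> seq int) (ts : nat -> R)
    (G : nat -> seq (seq int)) (j k : nat) (ss : nat -> seq int) : set Om :=
  [set w | (forall i, (i < j)%N -> h w (ts i) \in G i) /\
           (forall i, (j <= i <= k)%N -> h w (ts i) = ss i)].

Lemma measurable_cylinder {R : realType} {d : measure_display} {Om : measurableType d}
    (h : Om -> R -> seq int) (ts : nat -> R) G j k ss :
  (forall t s, 0 <= t -> measurable [set w | h w t = s]) -> (forall i, 0 <= ts i) ->
  measurable (cylinder h ts G j k ss).
Proof.
move=> mh t0; apply: measurableI; apply: measurable_forall_nat => i _; last exact: mh.
by apply: measurable_mem_fibers => y; exact: mh.
Qed.

(** The Markov property for a past known only through membership in [G]. Induction on [j]: at 0 it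
    is the product formula, and [split] decomposes over the value at one more time. *)
Lemma cylinder_markov {R : realType} {d : measure_display} {Om : measurableType d}
    (P : probability Om R) L h0 (h : Om -> R -> seq int) (ts : nat -> R) G j k ss :
  corner_flip_process P L h0 h -> 0 <= ts 0%N -> (forall i, ts i <= ts i.+1) ->
  (forall i, uniq (G i)) -> (j <= k)%N ->
  fine (P (cylinder h ts G j k.+1 ss)) =
  fine (P (cylinder h ts G j k ss)) * trans L (ts k.+1 - ts k) (ss k) (ss k.+1).
Proof.
move=> [_ [mh fdd]] t0 tS uG; have ti i : 0 <= ts i.
  by elim: i => // i IH; apply: le_trans IH (tS i).
have mC i l s : measurable (cylinder h ts G i l s) by exact: measurable_cylinder.
have split i l s : (i < l)%N -> fine (P (cylinder h ts G i.+1 l s)) =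
    \sum_(g <- G i) fine (P (cylinder h ts G i l (fun m => if m == i then g else s m))).
  move=> il.
  pose X := [set w | forall m, (m < i)%N -> h w (ts m) \in G m] `&`
            [set w | forall m, (i < m <= l)%N -> h w (ts m) = s m].
  have mX : measurable X.
    apply: measurableI; apply: measurable_forall_nat => m _; last exact: mh.
    by apply: measurable_mem_fibers => y; exact: mh.
  transitivity (fine (P (X `&` [set w | h w (ts i) \in G i]))).
    congr (fine (P _)); apply/seteqP; split=> w /=.
      move=> [h1 h2]; split; last exact: h1.
      by split=> m /= hm; [apply: h1; lia|apply: h2; lia].
    move=> [[/= h1 h2] h3]; split=> m hm; last by apply: h2; lia.
    by have [->//|mi] := eqVneq m i; apply: h1; lia.
  rewrite fine_probability_split//; last by move=> y; exact: mh.
  apply: eq_bigr => g _; congr (fine (P _)); apply/seteqP; split=> w /=.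
    move=> [[/= h1 h2] h3]; split=> // m hm.
    by case: eqP => [->//|mi]; apply: h2; lia.
  move=> [h1 h2]; split; last by rewrite h2 ?eqxx//; lia.
  split=> m /= hm; first exact: h1.
  by have := h2 m ltac:(lia); case: eqP => // mi; lia.
elim: j k ss => [|j IH] k ss jk.
  have E l : P (cylinder h ts G 0 l ss) =
      (trans L (ts 0%N) h0 (ss 0%N) *
       \prod_(i < l) trans L (ts i.+1 - ts i) (ss i) (ss i.+1))%:E.
    rewrite -fdd//; congr (P _); apply/seteqP; split=> w /=.
      by move=> [_ h2] i il; exact: h2.
    by move=> h2; split=> // i il; exact: h2.
  by rewrite !E/= big_ord_recr/= mulrA.
rewrite !split//; last by lia.
rewrite mulr_suml; apply: eq_bigr => g _; rewrite IH; last by lia.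
by rewrite (gtn_eqF jk) (gtn_eqF (leqW jk)).
Qed.

(** Doob's maximal inequality written with finite sums. The energy minus [lam], integrated over the
    paths that have stayed good, gains at most one error term per step, and at the end it is at
    least [- lam] times the probability of having stayed good. *)
Lemma skeleton_bound {R : realType} {d : measure_display} {Om : measurableType d}
    (P : probability Om R) L e h0 (h : Om -> R -> seq int) (u : nat -> nat -> R)
    (tau U C lam : R) n :
  (0 < L)%N -> admissible L e h0 -> corner_flip_process P L h0 h ->
  0 <= tau <= 1 -> 0 <= lam -> 0 <= U -> 0 <= C ->
  (forall k, u k 0%N = 0) -> (forall k, u k L = e%:~R) ->
  (forall k y, (0 < y < L)%N -> `|u k y| <= U) ->
  (forall k y, (0 < y < L)%N ->
     `|u k.+1 y - u k y - tau / 2 * laplacian (u k.+1) y| <= C * tau ^+ 2) ->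
  lam - (energy L (u 0%N) h0 + n%:R * (tau * (2 * L%:R ^+ 2) + tau ^+ 2 * step_constant L U C lam))
  <= lam * fine (P [set w | forall k, (k <= n)%N ->
      h w (k%:R * tau) \in [seq s <- heights L e | energy L (u k) s <= lam]]).
Proof.
move=> L0 v0 proc tau01 lam0 U0 C0 u0 uL uU uC.
pose G k := [seq s <- heights L e | energy L (u k) s <= lam].
pose ts (i : nat) : R := i%:R * tau.
have tau0 : 0 <= tau by case/andP: tau01.
have ts0 i : 0 <= ts i by rewrite mulr_ge0.
have tsS i : ts i <= ts i.+1 by rewrite ler_wpM2r// ler_nat.
have tsB i : ts i.+1 - ts i = tau by rewrite /ts -natr1; ring.
have uG i : uniq (G i) by rewrite filter_uniq// heights_uniq.
case: (proc) => _ [mh fdd].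
have mC i l s : measurable (cylinder h ts G i l s) by exact: measurable_cylinder.
pose q k s := fine (P (cylinder h ts G k k (fun=> s))).
(* The mass arriving at [b] at step [k + 1] before bad states are discarded. By [q'E] it is a
   probability, hence nonnegative; the power series [trans] shows no sign. *)
pose q' k b := \sum_(s <- G k) q k s * trans L tau s b.
have q'E k b : q' k b = fine (P ([set w | forall i, (i < k.+1)%N -> h w (ts i) \in G i]
                                 `&` [set w | h w (ts k.+1) = b])).
  rewrite /q'; transitivity (\sum_(s <- G k) fine (P (
      ([set w | forall i, (i < k)%N -> h w (ts i) \in G i] `&` [set w | h w (ts k.+1) = b])
      `&` [set w | h w (ts k) = s]))).
    apply: eq_bigr => s _; pose ss i := if i == k.+1 then b else s.
    have := cylinder_markov P L h0 h ts G k k ss proc (ts0 0%N) tsS uG (leqnn k).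
    rewrite tsB /ss eqxx (_ : (k == k.+1) = false); last by lia.
    have -> : q k s = fine (P (cylinder h ts G k k (fun i => if i == k.+1 then b else s))).
      congr (fine (P _)); apply/seteqP; split=> w [h1 h2]; split=> // i ik.
        by rewrite h2//; case: eqP => // ik'; lia.
      by rewrite h2//; case: eqP => // ik'; lia.
    move=> <-; congr (fine (P _)); apply/seteqP; split=> w /=.
      move=> [h1 h2]; split; first split=> //.
        by rewrite h2 ?eqxx//; lia.
      by rewrite h2; [case: eqP => // ?; lia|lia].
    move=> [[h1 h2] h3]; split=> // i ik; case: eqP => [->//|ik'].
    by have -> : i = k by lia.
  rewrite -fine_probability_split//.
  - congr (fine (P _)); apply/seteqP; split=> w /=.
      move=> [[h1 h2] h3]; split=> // i; rewrite ltnS leq_eqVlt => /orP[/eqP->//|]; exact: h1.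
    by move=> [h1 h2]; split; [split=> // i ik; apply: h1; lia|exact: h1].
  - apply: measurableI; last exact: mh.
    apply: measurable_forall_nat => i _; apply: measurable_mem_fibers => y; exact: mh.
  - by move=> y; exact: mh.
have q'0 k b : 0 <= q' k b by rewrite q'E fine_ge0.
have qS k b : b \in G k.+1 -> q k.+1 b = q' k b.
  move=> _; rewrite q'E; congr (fine (P _)); apply/seteqP; split=> w /=.
    by move=> [h1 h2]; split=> //; rewrite h2//; lia.
  by move=> [h1 h2]; split=> // i ik; have -> : i = k.+1 by lia.
have q0 k s : 0 <= q k s by rewrite fine_ge0.
have sumq k : \sum_(s <- G k) q k s = fine (P [set w | forall i, (i <= k)%N -> h w (ts i) \in G i]).
  transitivity (\sum_(s <- G k) fine (P (
      [set w | forall i, (i < k)%N -> h w (ts i) \in G i] `&` [set w | h w (ts k) = s]))).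
    apply: eq_bigr => s _; congr (fine (P _)); apply/seteqP; split=> w /=.
      by move=> [h1 h2]; split=> //; rewrite h2//; lia.
    by move=> [h1 h2]; split=> // i ik; have -> : i = k by lia.
  rewrite -fine_probability_split//.
  - congr (fine (P _)); apply/seteqP; split=> w /=.
      move=> [h1 h2] i; rewrite leq_eqVlt => /orP[/eqP->//|]; exact: h1.
    by move=> h1; split=> [i ik|]; apply: h1; lia.
  - apply: measurable_forall_nat => i _; apply: measurable_mem_fibers => y; exact: mh.
  - by move=> y; exact: mh.
have mgood k : measurable [set w | forall i, (i <= k)%N -> h w (ts i) \in G i].
  by apply: measurable_forall_nat => i _; apply: measurable_mem_fibers => y; exact: mh.
have sumq1 k : \sum_(s <- G k) q k s <= 1.
  by rewrite sumq -[1]/(fine 1%:E) fine_le ?fin_num_measure ?probability_le1.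
have drop k (p : seq int -> R) : (forall b, 0 <= p b) ->
    \sum_(b <- G k) p b * (energy L (u k) b - lam)
    <= \sum_(b <- heights L e) p b * (energy L (u k) b - lam).
  move=> p0; rewrite big_filter [leRHS](bigID (fun b => energy L (u k) b <= lam))/= lerDl.
  apply: sumr_ge0 => b; rewrite -ltNge => hb.
  by rewrite mulr_ge0// subr_ge0 ltW.
set err := tau * _ + _.
have energy_bound k b : admissible L e b -> `|energy L (u k) b - lam| <= L%:R ^+ 3 * (L%:R + U) * (L%:R + U) + lam.
  move=> vb; apply: le_trans (ler_normB _ _) _; rewrite (ger0_norm lam0) lerD2r.
  by apply: hdot_bound; rewrite ?addr_ge0// => y yL; apply: deviation_bound vb _; exact: uU.
have err0 : 0 <= err.
  rewrite /err /step_constant; apply: addr_ge0; first by rewrite mulr_ge0// mulr_ge0// sqr_ge0.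
  by rewrite mulr_ge0 ?sqr_ge0// !(addr_ge0, mulr_ge0, exprn_ge0, expR_ge0).
(* The stopped process: [q k s] is the mass at [s] after [k] steps inside the
   good set, and killing at energy above [lam] only decreases [N]. *)
pose N k := \sum_(s <- G k) q k s * (energy L (u k) s - lam).
(* At time 0 the Taylor bound has no remainder, so the initial law integrates like the point mass at
   [h0]. *)
have N0 : N 0%N <= energy L (u 0%N) h0 - lam.
  have q00 s : q 0%N s = trans L 0 h0 s.
    transitivity (fine (P [set w | forall i, (i <= 0)%N -> h w (ts i) = (fun=> s) i])).
      congr (fine (P _)); apply/seteqP; split=> w /=; first by case=> _ h2 i i0; apply: h2.
      by move=> h2; split.
    by rewrite fdd// big_ord0 mulr1/= /ts mul0r.
  apply: le_trans (drop _ _ (q0 _)) _.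
  under eq_bigr do rewrite q00.
  have := trans_taylor L e _ _ 0 h0 v0 (energy_bound 0%N).
  rewrite lexx ler01/= expr0n/= !mul0r addr0 => /(_ isT).
  by rewrite normr_le0 subr_eq0 => /eqP ->.
have NS k : N k.+1 <= N k + err.
  rewrite /N (eq_big_seq (fun b => q' k b * (energy L (u k.+1) b - lam))); last first.
    by move=> b bG; rewrite qS.
  apply: le_trans (drop _ _ (q'0 _)) _.
  under eq_bigr do rewrite mulr_suml.
  rewrite exchange_big/=.
  apply: (@le_trans _ _ (\sum_(s <- G k) q k s * (energy L (u k) s - lam + err))).
    rewrite [leLHS]big_seq [leRHS]big_seq; apply: ler_sum => s sG.
    under eq_bigr do rewrite -mulrA.
    rewrite -mulr_sumr ler_wpM2l//.
    have vs : admissible L e s by apply/mem_heights; move: sG; rewrite mem_filter => /andP[].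
    have := energy_step L e (u k) (u k.+1) U C lam tau s L0 vs (u0 _) (uL _) tau01 lam0 U0 C0
      (uU k.+1) (uC k).
    by rewrite /err addrA.
  rewrite (eq_bigr (fun s => q k s * (energy L (u k) s - lam) + q k s * err)); last first.
    by move=> s _; rewrite mulrDr.
  rewrite big_split/= -mulr_suml lerD2l -[leRHS]mul1r.
  exact: ler_wpM2r.
have Nn k : N k <= energy L (u 0%N) h0 - lam + k%:R * err.
  elim: k => [|k IH]; first by rewrite mul0r addr0.
  by apply: le_trans (NS k) _; rewrite -natr1; lra.
have Nlow : - (lam * \sum_(s <- G n) q n s) <= N n.
  rewrite -mulNr mulr_sumr; apply: ler_sum => s _.
  rewrite mulrC ler_wpM2l// lerBrDr addrC subrr; exact: hdot_ge0.
have := Nn n; rewrite sumq in Nlow; lra.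
Qed.

Lemma dyadic_small {R : realType} (x eps : R) : 0 <= x -> 0 < eps ->
  exists N, forall n, (N <= n)%N -> x / 2 ^+ n <= eps.
Proof.
move=> x0 eps0; exists (Num.bound (x / eps)) => n Nn.
rewrite ler_pdivrMr ?exprn_gt0// mulrC -ler_pdivrMr//.
apply/ltW; apply: lt_le_trans (archi_boundP _) _; first by rewrite divr_ge0// ltW.
apply: (@le_trans _ _ n%:R); first by rewrite ler_nat.
by rewrite -natrX ler_nat ltnW// ltn_expl.
Qed.

(** The dyadic grids are nested, so the good events decrease and continuity from above applies;
    about 2^n steps with quadratic error of order 4^-n leave nothing in the limit. Right-continuity
    carries a good grid time just after [t] back to [t], at the price of evaluating [u] at that
    later time. *)
Lemma path_bound {R : realType} {d : measure_display} {Om : measurableType d}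
    (P : probability Om R) L e h0 (h : Om -> R -> seq int) (u : R -> nat -> R)
    (T U C lam : R) :
  (0 < L)%N -> admissible L e h0 -> corner_flip_process P L h0 h ->
  0 < T -> 0 < lam -> 0 <= U -> 0 <= C ->
  (forall t, u t 0%N = 0) -> (forall t, u t L = e%:~R) ->
  (forall (t : R) y, 0 <= t -> (0 < y < L)%N -> `|u t y| <= U) ->
  (forall (t tau : R) y, 0 <= t -> 0 <= tau <= 1 -> (0 < y < L)%N ->
     `|u (t + tau) y - u t y - tau / 2 * laplacian (u (t + tau)) y| <= C * tau ^+ 2) ->
  exists2 G : set Om,
    measurable G /\ ((1 - (energy L (u 0) h0 + T * (2 * L%:R ^+ 2)) / lam)%:E <= P G)%E &
    forall w, G w -> forall t delta : R, 0 <= t < T -> 0 < delta ->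
      exists s, [/\ t <= s < t + delta, s <= T, admissible L e (h w t) &
                    energy L (u s) (h w t) <= lam].
Proof.
move=> L0 v0 proc T0 lam0 U0 C0 u0 uL uU uC.
(* The grids start at a level where the mesh is at most 1, as the Taylor bound demands. *)
have [n0 hn0] := dyadic_small T 1 (ltW T0) ltr01.
pose tau n := T / 2 ^+ (n + n0).
have tau01 n : 0 <= tau n <= 1.
  by rewrite divr_ge0 ?exprn_ge0 ?(ltW T0)//= hn0// leq_addl.
have tauE n k : (k.*2)%:R * tau n.+1 = k%:R * tau n.
  rewrite /tau addSn exprS -muln2 natrM; field.
  by rewrite expf_neq0.
pose A n := [set w | forall k, (k <= 2 ^ (n + n0))%N ->
      h w (k%:R * tau n) \in [seq s <- heights L e | energy L (u (k%:R * tau n)) s <= lam]].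
case: (proc) => cad [mh _].
have mA n : measurable (A n).
  apply: measurable_forall_nat => i _; apply: measurable_mem_fibers => y; apply: mh.
  by rewrite mulr_ge0//; case/andP: (tau01 n).
have mG : measurable (\bigcap_n A n) by exact: bigcap_measurableType.
pose F0 := energy L (u 0) h0; pose K := step_constant L U C lam.
have PA n : 1 - (F0 + T * (2 * L%:R ^+ 2)) / lam - T * T * K / lam / 2 ^+ (n + n0) <= fine (P (A n)).
  have := skeleton_bound P L e h0 h (fun k => u (k%:R * tau n)) (tau n) U C lam (2 ^ (n + n0))
    L0 v0 proc (tau01 n) (ltW lam0) U0 C0 (fun k => u0 _) (fun k => uL _) _ _.
  rewrite mul0r -/F0 -/K -/(A n) => /(_ _ _) H.
  rewrite -(ler_pM2l lam0); apply: le_trans (H _ _).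
  - rewrite natrX /tau le_eqVlt; apply/orP; left; apply/eqP; field.
    by rewrite expf_neq0// gt_eqF.
  - move=> k y yL; apply: uU => //; rewrite mulr_ge0//; by case/andP: (tau01 n).
  - move=> k y yL; rewrite -natr1 mulrDl mul1r; apply: uC => //.
    by rewrite mulr_ge0//; case/andP: (tau01 n).
exists (\bigcap_n A n); first split => //.
  have PG : P (\bigcap_n A n) \is a fin_num by exact: fin_num_measure.
  rewrite -(fineK PG) lee_fin.
  have cP : fine (P (A n)) @[n --> \oo] --> fine (P (\bigcap_n A n)).
    apply: fine_cvg; rewrite fineK//; apply: nonincreasing_cvg_mu => //.
      by rewrite ltey_eq fin_num_measure.
    apply/nonincreasing_seqP => n; apply/subsetPset => w /= h1 k kn.
    rewrite -tauE; apply: h1; rewrite addSn expnS; lia.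
  apply/ler_addgt0Pr => eps eps0; rewrite -lerBlDr.
  have K0 : 0 <= T * T * K / lam.
    rewrite divr_ge0 ?(ltW lam0)// mulr_ge0 ?mulr_ge0 ?(ltW T0)// /K /step_constant.
    by rewrite !(addr_ge0, mulr_ge0, exprn_ge0, expR_ge0)// ltW.
  have [N hN] := dyadic_small _ _ K0 eps0.
  rewrite -(cvg_lim (@Rhausdorff _) cP); apply: limr_ge; first by apply/cvg_ex; exists (fine (P (\bigcap_n A n))).
  near=> n; apply: le_trans (PA n); rewrite lerB//; apply: hN.
  apply: leq_trans (leq_addr _ _); near: n; exact: nbhs_infty_ge.
move=> w Gw t delta /andP[t0 tT] delta0.
have [d1 d10 hd1] := (cad w).1 t t0.
pose dd := Num.min delta d1; have dd0 : 0 < dd by rewrite lt_min delta0.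
have [N hN] := dyadic_small T (dd / 2) (ltW T0) ltac:(by rewrite divr_gt0).
have tauN : tau N < dd.
  by apply: le_lt_trans (hN _ (leq_addr _ _)) _; rewrite ltr_pdivrMr// ltr_pMr// ltr1n.
have tau0 : 0 < tau N by rewrite divr_gt0// exprn_gt0.
(* The first grid point strictly after [t]; since [t < T], it does not pass [T]. *)
pose k := (Num.truncn (t / tau N)).+1.
have tk : t < k%:R * tau N by rewrite -ltr_pdivrMr// truncnS_gt.
have kt : k%:R * tau N <= t + tau N.
  rewrite -natr1 mulrDl mul1r lerD2r -ler_pdivlMr//.
  by rewrite truncn_le// divr_ge0// ltW.
have kN : (k <= 2 ^ (N + n0))%N.
  rewrite /k -(@ltr_nat R); apply: le_lt_trans (_ : t / tau N < _).
    by rewrite truncn_le// divr_ge0// ltW.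
  rewrite ltr_pdivrMr// natrX /tau mulrC divfK// expf_neq0//.
have hk : h w (k%:R * tau N) = h w t.
  apply: hd1; first exact: ltW.
  apply: le_lt_trans kt _; rewrite ltrD2l; apply: lt_le_trans tauN _.
  by rewrite ge_min lexx orbT.
have := Gw N I k kN; rewrite hk mem_filter => /andP[en /mem_heights va].
exists (k%:R * tau N); split=> //.
  rewrite ltW//=; apply: le_lt_trans kt _; rewrite ltrD2l; apply: lt_le_trans tauN _.
  by rewrite ge_min lexx.
have : k%:R * tau N <= (2 ^ (N + n0))%:R * tau N by rewrite ler_wpM2r ?(ltW tau0)// ler_nat.
have -> // : (2 ^ (N + n0))%:R * tau N = T by rewrite natrX /tau mulrC divfK// expf_neq0.
Unshelve. all: by end_near.
Qed.

(** * Approximation by sine sums *)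

Lemma sin_ge_mul_cos {R : realType} (w : R) : 0 <= w <= pi / 2 -> w * cos w <= sin w.
Proof.
case/andP; rewrite le_eqVlt => /orP[/eqP <- _|w0 wp]; first by rewrite mul0r sin0.
have [c /[!in_itv]/= /andP[c0 cw]] := @MVT R sin cos 0 w w0
  (fun x _ => is_derive_sin x) ltac:(by apply: continuous_subspaceT => x; exact: continuous_sin).
rewrite sin0 !subr0 => ->; rewrite mulrC ler_wpM2r ?(ltW w0)//.
have pi0 := @pi_gt0 R.
rewrite leNgt ltr_cos ?in_itv/=; first by rewrite -leNgt ltW.
all: by apply/andP; split; lra.
Qed.

(** Halve the angle: sin z = 2 sin(z/2) cos(z/2) is at least z cos(z/2)^2, and cos(z/2)^2 >= 1/2
    because cos z >= 0. *)
Lemma sin_ge_half {R : realType} (z : R) : 0 <= z <= pi / 2 -> z / 2 <= sin z.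
Proof.
move=> /andP[z0 zp]; have pi0 := @pi_gt0 R.
have h1 : z / 2 * cos (z / 2) <= sin (z / 2) by apply: sin_ge_mul_cos; apply/andP; split; lra.
have c0 : 0 <= cos (z / 2) by apply: cos_ge0_pihalf; apply/andP; split; lra.
have c1 : 0 <= cos z by apply: cos_ge0_pihalf; apply/andP; split; lra.
have zE : z = (z / 2) *+ 2 by rewrite mulr2n; lra.
move: c1; rewrite zE sin_mulr2n cos_mulr2n mulr2n => c1.
rewrite -zE; have := ler_wpM2l c0 h1; nra.
Qed.

Lemma sin_lipschitz {R : realType} (x y : R) : `|sin x - sin y| <= `|x - y|.
Proof.
wlog xy : x y / x < y => [H|].
  have [xy|yx|->] := ltgtP x y; first exact: H.
    by rewrite distrC (distrC x); exact: H.
  by rewrite !subrr.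
have [c _] := @MVT R sin cos x y xy
  (fun x _ => is_derive_sin x) ltac:(by apply: continuous_subspaceT => z; exact: continuous_sin).
rewrite distrC (distrC x) => ->; rewrite normrM -[leRHS]mul1r ler_wpM2r//; exact: cos_max.
Qed.

(* [sin (pi * x)] times a polynomial in [chord x] is a sine sum. *)
Definition chord {R : realType} (x : R) : R := (1 - cos (pi * x)) / 2.

(** For z <= x the difference of cosines is a product of two sines, each at least (x - z) / 2. *)
Lemma chord_distance {R : realType} (x z : R) : 0 <= x <= 1 -> 0 <= z <= 1 ->
  (x - z) ^+ 2 <= 4 * `|chord x - chord z|.
Proof.
wlog xz : x z / z <= x => [H x01 z01|].
  have [zx|/ltW xz] := leP z x; first exact: H.
  by rewrite -sqrrN opprB distrC; exact: H.
move=> /andP[x0 x1] /andP[z0 z1].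
have p2 := @pi_ge2 R.
have -> : chord x - chord z = sin (pi * (x + z) / 2) * sin (pi * (x - z) / 2).
  have e1 : pi * x = pi * (x + z) / 2 + pi * (x - z) / 2 by lra.
  have e2 : pi * z = pi * (x + z) / 2 - pi * (x - z) / 2 by lra.
  rewrite /chord e1 e2 cosD cosB; lra.
have low (v : R) : 0 <= v <= 1 -> v / 2 <= sin (pi * v / 2).
  move=> /andP[v0 v1].
  have := sin_ge_half (pi * v / 2) ltac:(apply/andP; split; nra); nra.
have h1 : (x - z) / 2 <= sin (pi * (x - z) / 2) by apply: low; apply/andP; split; lra.
(* Beyond 1 the sum x + z is reflected to 2 - (x + z), which is still at least x - z. *)
have h2 : (x - z) / 2 <= sin (pi * (x + z) / 2).
  have [xz1|xz1] := leP (x + z) 1.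
    have := low (x + z) ltac:(apply/andP; split; lra); lra.
  have -> : sin (pi * (x + z) / 2) = sin (pi * (2 - (x + z)) / 2).
    have -> : pi * (2 - (x + z)) / 2 = - (pi * (x + z) / 2) + pi by lra.
    by rewrite sinDpi sinN opprK.
  have := low (2 - (x + z)) ltac:(apply/andP; split; lra); lra.
rewrite ger0_norm; last by rewrite mulr_ge0//; lra.
rewrite expr2; nra.
Qed.

(* The Bernstein polynomial [\sum_(j <= n) 'C(n, j) c_j y^j (1 - y)^(n - j)],
   by de Casteljau's recursion. *)
Fixpoint bernstein {R : realType} (n : nat) (c : nat -> R) (y : R) : R :=
  if n is m.+1 then (1 - y) * bernstein m c y + y * bernstein m (c \o succn) y else c 0%N.

Lemma eq_bernstein {R : realType} n (c c' : nat -> R) y : c =1 c' ->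
  bernstein n c y = bernstein n c' y.
Proof.
elim: n c c' => [|n IH] c c' cc /=; first exact: cc.
by rewrite (IH _ _ cc) (IH (c \o succn) (c' \o succn))// => j; exact: cc.
Qed.

Lemma bernstein_linear {R : realType} n (a b : R) (c c' : nat -> R) y :
  bernstein n (fun j => a * c j + b * c' j) y = a * bernstein n c y + b * bernstein n c' y.
Proof.
elim: n c c' => [//|n IH] c c' /=; rewrite IH.
rewrite (_ : _ \o succn = fun j => a * (c \o succn) j + b * (c' \o succn) j)// IH; ring.
Qed.

Lemma bernstein_cst {R : realType} n (a y : R) : bernstein n (fun=> a) y = a.
Proof.
elim: n => [//|n IH] /=.
by rewrite (_ : (fun=> a) \o succn = fun=> a)// IH -mulrDl subrK mul1r.
Qed.

Lemma bernstein_le {R : realType} n (c c' : nat -> R) y : 0 <= y <= 1 ->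
  (forall j, (j <= n)%N -> c j <= c' j) -> bernstein n c y <= bernstein n c' y.
Proof.
move=> /andP[y0 y1]; elim: n c c' => [|n IH] c c' cc /=; first exact: cc.
apply: lerD; rewrite ler_wpM2l ?subr_ge0//; apply: IH => j jn; apply: cc => //=.
exact: leqW.
Qed.

(** The variance of a binomial variable. One more trial shifts the centred value by -y with weight 1
    - y and by 1 - y with weight y; the terms in the mean [M] cancel between the two. *)
Lemma bernstein_variance {R : realType} n (y : R) :
  bernstein n (fun j => (j%:R - n%:R * y) ^+ 2) y = n%:R * (y * (1 - y)).
Proof.
elim: n => [|n IH] /=; first by rewrite !mul0r subrr expr0n.
set V := bernstein n _ y in IH.
pose M := bernstein n (fun j => j%:R - n%:R * y) y.
have shift a : bernstein n (fun j => (j%:R - n%:R * y + a) ^+ 2) y = V + 2 * a * M + a ^+ 2.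
  rewrite (eq_bernstein _ _ (fun j => 1 * (j%:R - n%:R * y) ^+ 2 +
    1 * (2 * a * (j%:R - n%:R * y) + 1 * a ^+ 2))); last by move=> j; ring.
  by rewrite !bernstein_linear bernstein_cst -/V -/M; ring.
rewrite (eq_bernstein n (fun j => (j%:R - n.+1%:R * y) ^+ 2)
   (fun j => (j%:R - n%:R * y + (- y)) ^+ 2)); last by move=> j; rewrite -natr1; ring.
rewrite (eq_bernstein n (_ \o succn) (fun j => (j%:R - n%:R * y + (1 - y)) ^+ 2)); last first.
  by move=> j /=; rewrite -!natr1; ring.
by rewrite !shift IH -natr1; ring.
Qed.

Definition sine_sum {R : realType} (s : seq (R * nat)) (x : R) : R :=
  \sum_(p <- s) p.1 * sin (p.2%:R * pi * x).

Definition is_sine_sum {R : realType} (f : R -> R) : Prop :=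
  exists s, forall x, f x = sine_sum s x.

Lemma is_sine_sum_linear {R : realType} (a b : R) (f g : R -> R) :
  is_sine_sum f -> is_sine_sum g -> is_sine_sum (fun x => a * f x + b * g x).
Proof.
move=> [s hs] [r hr].
exists ([seq (a * p.1, p.2) | p <- s] ++ [seq (b * p.1, p.2) | p <- r]) => x.
rewrite /sine_sum big_cat !big_map/= hs hr /sine_sum !mulr_sumr.
by congr (_ + _); apply: eq_bigr => p _; rewrite mulrA.
Qed.

(** Product-to-sum formula. Mode 0, which has no lower neighbour in [nat], contributes nothing. *)
Lemma is_sine_sum_cos {R : realType} (f : R -> R) :
  is_sine_sum f -> is_sine_sum (fun x => cos (pi * x) * f x).
Proof.
move=> [s hs]; elim: s f hs => [|[c k] s IH] f hs.
  by exists [::] => x; rewrite hs /sine_sum !big_nil mulr0.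
have [r hr] := IH (fun x => sine_sum s x) (fun=> erefl).
have [q hq] : is_sine_sum (fun x => cos (pi * x) * (c * sin (k%:R * pi * x))).
  case: k {hs} => [|k].
    by exists [::] => x; rewrite /sine_sum big_nil !mul0r sin0 !mulr0.
  exists [:: (c / 2, k.+2); (c / 2, k)] => x.
  rewrite /sine_sum !big_cons big_nil/= addr0.
  have -> : k.+2%:R * pi * x = k.+1%:R * pi * x + pi * x by rewrite -[k.+2%:R]natr1; ring.
  have -> : k%:R * pi * x = k.+1%:R * pi * x - pi * x by rewrite -[k.+1%:R]natr1; ring.
  by rewrite sinD sinB; field.
exists (q ++ r) => x; rewrite /sine_sum big_cat/= -!/(sine_sum _ _) -hq -hr hs.
by rewrite /sine_sum big_cons mulrDr.
Qed.

(** De Casteljau's factors 1 - y and y are here (1 + cos(pi x)) / 2 and (1 - cos(pi x)) / 2, and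
    multiplication by the cosine preserves sine sums. *)
Lemma is_sine_sum_bernstein {R : realType} n (c : nat -> R) :
  is_sine_sum (fun x => sin (pi * x) * bernstein n c (chord x)).
Proof.
elim: n c => [|n IH] c /=.
  exists [:: (c 0%N, 1%N)] => x.
  by rewrite /sine_sum big_cons big_nil/= mul1r addr0 mulrC.
have h1 := IH c; have h2 := IH (c \o succn).
have := is_sine_sum_linear 2^-1 2^-1 _ _ h1 (is_sine_sum_cos _ h1).
have := is_sine_sum_linear 2^-1 (- 2^-1) _ _ h2 (is_sine_sum_cos _ h2).
move=> H2 H1; have [s hs] := is_sine_sum_linear 1 1 _ _ H1 H2.
by exists s => x; rewrite -hs /chord; field.
Qed.

(** A Bernstein approximation, in the variable [chord x], of [g] divided by sin(pi x). The quotient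
    is bounded but may oscillate at the endpoints; multiplying back by the sine before comparing
    gives an error linear in the distance to the node. *)
Lemma sine_sum_approx {R : realType} (g : R -> R) (delta : R) :
  (forall x y : R, 0 <= x <= 1 -> 0 <= y <= 1 -> `|g x - g y| <= 2 * `|x - y|) ->
  g 0 = 0 -> g 1 = 0 -> 0 < delta ->
  exists s, forall x : R, 0 <= x <= 1 -> `|g x - sine_sum s x| <= delta.
Proof.
move=> gL g0 g1 d0.
have p2 := @pi_ge2 R; have p4 : pi <= 4 :> R by have := @pihalf_lt2 R; lra.
have sin0x x : 0 <= x <= 1 -> 0 <= sin (pi * x) :> R.
  move=> /andP[x0 x1]; apply: sin_ge0_pi; rewrite mulr_ge0 ?pi_ge0//=.
  by rewrite -[leRHS]mulr1 ler_wpM2l ?pi_ge0.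
have gsin x : 0 <= x <= 1 -> `|g x| <= 2 * sin (pi * x).
  move=> /andP[x0 x1]; have [x2|x2] := leP x 2^-1.
    have := gL x 0 ltac:(apply/andP; split; lra) ltac:(apply/andP; split; lra).
    rewrite g0 !subr0 (ger0_norm x0) => h.
    have px : 2 * x <= pi * x by rewrite ler_wpM2r.
    have px2 : pi * x <= pi * 2^-1 by rewrite ler_wpM2l// pi_ge0.
    have := sin_ge_half (pi * x) ltac:(apply/andP; split; lra); lra.
  have := gL x 1 ltac:(apply/andP; split; lra) ltac:(apply/andP; split; lra).
  rewrite g1 subr0 (distrC x 1) (ger0_norm (_ : 0 <= 1 - x)) ?subr_ge0// => h.
  have px : 2 * (1 - x) <= pi * (1 - x) by rewrite ler_wpM2r// subr_ge0.
  have px2 : pi * (1 - x) <= pi * 2^-1 by rewrite ler_wpM2l ?pi_ge0//; lra.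
  have := sin_ge_half (pi * (1 - x)) ltac:(apply/andP; split; lra).
  have -> : sin (pi * (1 - x)) = sin (pi * x).
    by rewrite mulrBr mulr1 addrC sinDpi sinN opprK.
  lra.
(* Half of [delta] goes to [10 * om], the other half to the variance term 160 / (om^3 n). *)
pose om := delta / 20; have om0 : 0 < om by rewrite divr_gt0.
pose n := (Num.bound (160 / om ^+ 3 / (delta / 2))).+1.
have nbig : 160 / om ^+ 3 <= n%:R * (delta / 2).
  rewrite -ler_pdivrMr ?divr_gt0//; apply/ltW; apply: lt_le_trans (archi_boundP _) _.
    by rewrite !divr_ge0// ?exprn_ge0// ltW.
  by rewrite ler_nat.
have n0 : 0 < n%:R :> R by rewrite ltr0n.
(* The point that [chord] sends to j / n. *)
pose nd j : R := acos (1 - 2 * (j%:R / n%:R)) / pi.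
have jn1 j : (j <= n)%N -> 0 <= (j%:R / n%:R : R) <= 1.
  by move=> jn; rewrite divr_ge0//= ler_pdivrMr// mul1r ler_nat.
have nd01 j : (j <= n)%N -> 0 <= nd j <= 1.
  move=> /jn1 /andP[j0 j1]; rewrite /nd divr_ge0 ?acos_ge0 ?pi_ge0//=.
    by rewrite ler_pdivrMr ?pi_gt0// mul1r acos_lepi//; apply/andP; split; lra.
  by apply/andP; split; lra.
have chord_nd j : (j <= n)%N -> chord (nd j) = j%:R / n%:R.
  move=> /jn1 /andP[j0 j1].
  have -> : chord (nd j) = (1 - cos (acos (1 - 2 * (j%:R / n%:R)))) / 2.
    by rewrite /chord /nd [pi * _]mulrC divfK// gt_eqF// pi_gt0.
  rewrite acosK; first by lra.
  by rewrite in_itv/=; apply/andP; split; lra.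
(* Where the sine vanishes the quotient is 0 by convention, and [gsin] forces [g] to vanish there
   too. *)
pose r j := g (nd j) / sin (pi * nd j).
have rE j : (j <= n)%N -> g (nd j) = sin (pi * nd j) * r j.
  move=> jn; rewrite /r mulrC; have [s0|s0] := eqVneq (sin (pi * nd j)) 0; last by rewrite divfK.
  by have := gsin _ (nd01 _ jn); rewrite s0 mulr0 normr_le0 mulr0 => /eqP.
have r2 j : (j <= n)%N -> `|r j| <= 2.
  move=> jn; have := gsin _ (nd01 _ jn); have := sin0x _ (nd01 _ jn).
  rewrite le_eqVlt => /orP[/eqP s0 _|s0]; first by rewrite /r -s0 invr0 mulr0 normr0.
  by rewrite /r normrM normfV (gtr0_norm s0) ler_pdivrMr.
have [s hs] := is_sine_sum_bernstein n r; exists s => x x01; rewrite -hs.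
have y01 : 0 <= chord x <= 1.
  by rewrite /chord; have := cos_le1 (pi * x); have := cos_geN1 (pi * x) => h1 h2; apply/andP; split; lra.
set y := chord x in y01 *; set S := sin _.
have -> : g x - S * bernstein n r y = bernstein n (fun j => g x - S * r j) y.
  rewrite (eq_bernstein n (fun j => g x - S * r j) (fun j => 1 * g x + (- S) * r j)); last first.
    by move=> j; ring.
  by rewrite bernstein_linear bernstein_cst; ring.
(* With z the distance to the node, z <= om + z^4 / om^3 and z^4 <= 16 (y - j/n)^2 by
   [chord_distance]: the fourth power brings in the variance. The factor 10 is 2 + 2 * 4, from the
   Lipschitz constant of [g], the bound on [r] and pi <= 4. *)
pose E (j : nat) : R := 10 * (om + 16 / om ^+ 3 * (y - j%:R / n%:R) ^+ 2).
have hE j : (j <= n)%N -> `|g x - S * r j| <= E j.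
  move=> jn; have := chord_distance _ _ x01 (nd01 _ jn); rewrite (chord_nd _ jn) -/y => hc.
  have h1 : `|g x - S * r j| <= 10 * `|x - nd j|.
    have -> : g x - S * r j = (g x - g (nd j)) + r j * (sin (pi * nd j) - S).
      by rewrite [in RHS]rE//; ring.
    apply: le_trans (ler_normD _ _) _; rewrite normrM.
    have a1 := gL _ _ x01 (nd01 _ jn).
    have a2 := sin_lipschitz (pi * nd j) (pi * x).
    rewrite -mulrBr normrM (gtr0_norm (@pi_gt0 R)) [`|nd j - x|]distrC -/S in a2.
    have a3 := ler_pM (normr_ge0 _) (normr_ge0 _) (r2 _ jn) a2.
    have a4 : pi * `|x - nd j| <= 4 * `|x - nd j| by rewrite ler_wpM2r.
    lra.
  apply: le_trans h1 _; rewrite ler_wpM2l//.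
  set z := `|x - nd j| in hc *; have z0 : 0 <= z by rewrite /z.
  have hz2 : z ^+ 2 <= 4 * `|y - j%:R / n%:R| by rewrite real_normK ?num_real.
  have hz : z ^+ 4 <= 16 * (y - j%:R / n%:R) ^+ 2.
    rewrite -[in leRHS]real_normK ?num_real// (_ : 16 = 4 ^+ 2); last by ring.
    by rewrite -exprMn (exprM z 2 2) lerXn2r// ?nnegrE ?exprn_ge0// mulr_ge0.
  have [zo|zo] := leP z om.
    by apply: le_trans zo _; rewrite lerDl mulr_ge0 ?sqr_ge0// divr_ge0// exprn_ge0// ltW.
  apply: (@le_trans _ _ (z ^+ 4 / om ^+ 3)).
    rewrite ler_pdivlMr ?exprn_gt0// (_ : z ^+ 4 = z * z ^+ 3); last by ring.
    by rewrite ler_wpM2l// lerXn2r ?nnegrE// ltW.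
  rewrite -[X in X <= _]add0r; apply: lerD; first exact: ltW.
  by rewrite [leRHS]mulrAC ler_wpM2r// invr_ge0 exprn_ge0// ltW.
have bE : bernstein n E y <= delta.
  rewrite (eq_bernstein n E (fun j => 1 * (10 * om) + (160 / om ^+ 3 / n%:R ^+ 2) * (j%:R - n%:R * y) ^+ 2)).
    rewrite bernstein_linear bernstein_cst bernstein_variance mul1r.
    have -> : 160 / om ^+ 3 / n%:R ^+ 2 * (n%:R * (y * (1 - y))) = 160 / om ^+ 3 / n%:R * (y * (1 - y)).
      by field; rewrite !gt_eqF.
    have h1 : 160 / om ^+ 3 / n%:R <= delta / 2 by rewrite ler_pdivrMr// [leRHS]mulrC.
    have h2 : 0 <= 160 / om ^+ 3 / n%:R by rewrite !divr_ge0// exprn_ge0// ltW.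
    case/andP: y01 => y0 y1; have h3 : 0 <= y * (1 - y) <= 1.
      by rewrite mulr_ge0 ?subr_ge0//= mulr_ile1 ?subr_ge0// gerBl.
    case/andP: h3 => h3 h4; have -> : 10 * om = delta / 2 by rewrite /om; lra.
    have := ler_pM h2 h3 h1 h4; lra.
  by move=> j; rewrite /E; field; rewrite !gt_eqF.
rewrite ler_norml; apply/andP; split.
  apply: (@le_trans _ _ (bernstein n (fun j => - E j) y)).
    have -> : bernstein n (fun j => - E j) y = - bernstein n E y.
      rewrite (eq_bernstein n (fun j => - E j) (fun j => (-1) * E j + 0 * E j)); last by move=> j; ring.
      by rewrite bernstein_linear; ring.
    by rewrite lerN2.
  apply: bernstein_le => // j jn; have := hE _ jn; rewrite ler_norml => /andP[]//.
apply: le_trans bE; apply: bernstein_le => // j jn; have := hE _ jn; rewrite ler_norml => /andP[]//.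
Qed.

(** * Maximum principle for the heat equation *)

Lemma is_derive_pos_slope {R : realType} (f : R -> R) (x a : R) :
  is_derive x 1 f a -> 0 < a ->
  exists2 eta : R, 0 < eta & forall h, h != 0 -> `|h| < eta -> 0 < (f (x + h) - f x) / h.
Proof.
move=> [df <-] a0; have := df; rewrite /derivable => /cvg_ex[l hl].
have lE : l = 'D_1 f x by apply/esym; apply: cvg_lim hl.
rewrite -{}lE in a0.
have := cvgr_gt _ hl _ a0; rewrite near_withinE => -[eta /= eta0 H].
exists eta => // h h0 heta.
have := H h; rewrite /ball/= sub0r normrN => /(_ heta h0).
by rewrite /GRing.scale/= mulr1 mulrC [h + x]addrC.
Qed.

(** One-sided, because the maximum may lie on the final time slice. *)
Lemma derive_ge0_left_max {R : realType} (f : R -> R) (x a : R) : 0 < x ->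
  is_derive x 1 f a -> (forall y : R, 0 < y < x -> f y <= f x) -> 0 <= a.
Proof.
move=> x0 fa fx; rewrite leNgt; apply/negP => a0.
have fa' : is_derive x 1 (- f) (- a) by exact: is_deriveN.
have [eta eta0 H] := is_derive_pos_slope _ _ _ fa' ltac:(by rewrite oppr_gt0).
pose h := Num.min (eta / 2) (x / 2).
have h0 : 0 < h by rewrite lt_min !divr_gt0.
have h1 : h <= eta / 2 by rewrite ge_min lexx.
have h2 : h <= x / 2 by rewrite ge_min lexx orbT.
have := H (- h) ltac:(by rewrite oppr_eq0 gt_eqF) ltac:(by rewrite normrN gtr0_norm//; lra).
have := fx (x - h) ltac:(apply/andP; split; lra).
rewrite /= invrN mulrN -mulNr => hf; rewrite pmulr_lgt0 ?invr_gt0//.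
change ((- f) (x - h)) with (- f (x - h)); change ((- f) x) with (- f x); lra.
Qed.

(** If c > 0, the first derivative, zero at [x], is positive just to the right, and [f] exceeds its
    maximum there. *)
Lemma second_derive_le0_max {R : realType} (f b : R -> R) (x c : R) : 0 < x < 1 ->
  (forall y : R, 0 < y < 1 -> is_derive y 1 f (b y)) -> is_derive x 1 b c ->
  (forall y : R, 0 < y < 1 -> f y <= f x) -> c <= 0.
Proof.
move=> x01 fb bc fx; rewrite leNgt; apply/negP => c0.
have bx : b x = 0.
  have h := @derive1_at_max R f 0 1 x ler01 _ _ _.
  have := fb x x01 => fbx.
  have h0 : is_derive x 1 f 0.
    apply: h; last by move=> t; rewrite in_itv/=; exact: fx.
      by move=> t; rewrite in_itv/= => /fb [].
    by rewrite in_itv.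
  by rewrite -(@derive_val _ _ _ _ _ _ _ fbx) (@derive_val _ _ _ _ _ _ _ h0).
have [eta eta0 H] := is_derive_pos_slope _ _ _ bc c0.
case/andP: (x01) => x0 x1.
pose h := Num.min (eta / 2) ((1 - x) / 2).
have h0 : 0 < h by rewrite lt_min !divr_gt0// subr_gt0.
have h1 : h <= eta / 2 by rewrite ge_min lexx.
have h2 : h <= (1 - x) / 2 by rewrite ge_min lexx orbT.
have [z /[!in_itv]/= /andP[z1 z2] hz] := @MVT R f b x (x + h) ltac:(lra)
  ltac:(move=> y; rewrite in_itv/= => /andP[y1 y2]; apply: fb; apply/andP; split; lra)
  ltac:(apply: derivable_within_continuous => y; rewrite in_itv/= => /andP[y1 y2];
        have [] := fb y ltac:(apply/andP; split; lra); done).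
have := H (z - x) ltac:(by rewrite gt_eqF// subr_gt0) ltac:(by rewrite gtr0_norm; lra).
rewrite bx subr0 [x + _]addrC subrK pmulr_lgt0 ?invr_gt0 ?subr_gt0// => bz.
have := fx (x + h) ltac:(apply/andP; split; lra).
rewrite -subr_le0 hz addrC addKr leNgt => /negP; apply; exact: mulr_gt0.
Qed.

Lemma heat_max_principle {R : realType} (v a b c : R -> R -> R) (delta : R) :
  {within [set p : R * R | 0 <= p.1 <= 1 /\ 0 <= p.2],
     continuous (fun p : R * R => v p.1 p.2)} ->
  (forall x : R, 0 <= x <= 1 -> v x 0 <= delta) ->
  (forall t : R, 0 < t -> v 0 t <= delta /\ v 1 t <= delta) ->
  (forall x t : R, 0 < x < 1 -> 0 < t ->
     [/\ is_derive t 1 (v x) (a x t),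
         is_derive x 1 (v ^~ t) (b x t),
         is_derive x 1 (b ^~ t) (c x t) &
         a x t <= 2^-1 * c x t]) ->
  forall x t : R, 0 <= x <= 1 -> 0 <= t -> v x t <= delta.
Proof.
move=> vc v0 vb vd x t x01 t0; apply/ler_addgt0Pr => eps eps0.
have tp : 0 < t + 1 by rewrite ltr_wpDl.
(* Subtracting [ka * t] makes the inequality strict: a maximum off the parabolic boundary would need
   [a >= ka > 0] and [c <= 0]. The subtracted term is at most [eps]. *)
pose ka := eps / (t + 1); have ka0 : 0 < ka by rewrite divr_gt0.
pose K := `[0, 1]%classic `*` `[0, t]%classic : set (R * R).
pose w (p : R * R) := v p.1 p.2 - ka * p.2.
have wc : {within K, continuous w}.
  have vcK : {within K, continuous (fun p : R * R => v p.1 p.2)}.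
    apply: continuous_subspaceW vc => -[y s] [] /=.
    by rewrite !in_itv/= => h1 /andP[h2 _].
  have lc : {within K, continuous (fun p : R * R => ka * p.2)}.
    apply: continuous_subspaceT => p; apply: cvgM; first exact: cvg_cst.
    exact: cvg_snd.
  by move=> p; apply: cvgB; [exact: vcK|exact: lc].
have Kne : K !=set0 by exists (x, 0); split; rewrite /= in_itv/= ?lexx.
have Kc : compact K by apply: compact_setX; exact: segment_compact.
have [[x0 t1] /set_mem[/=]] := compact_EVT_max Kne Kc wc.
rewrite !in_itv/= => x001 /andP[t10 t1t] wmax.
have wm y s : 0 <= y <= 1 -> 0 <= s <= t -> v y s - ka * s <= v x0 t1 - ka * t1.
  by move=> y01 st; have := wmax (y, s); apply; apply/mem_set; split; rewrite /= in_itv.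
suff h : v x0 t1 - ka * t1 <= delta.
  have := wm x t x01 ltac:(by rewrite t0 lexx); have : ka * t <= eps.
    by rewrite /ka mulrAC ler_pdivrMr// ler_pM2l// lerDl.
  lra.
have kt1 : 0 <= ka * t1 by rewrite mulr_ge0// ltW.
have [t1E|t1n] := eqVneq t1 0; first by rewrite t1E in kt1 *; have := v0 _ x001; lra.
have t1p : 0 < t1 by rewrite lt_neqAle eq_sym t1n.
have [h0 h1] := vb _ t1p.
have [x0E|x0n] := eqVneq x0 0; first by rewrite x0E; lra.
have [x1E|x1n] := eqVneq x0 1; first by rewrite x1E; lra.
have x0i : 0 < x0 < 1 by case/andP: x001 => p q; rewrite !lt_neqAle p q x1n eq_sym x0n.
have [da _ dc ac] := vd _ _ x0i t1p.
have ha : 0 <= a x0 t1 - ka.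
  apply: (@derive_ge0_left_max R (fun s => v x0 s - ka * s) t1) => //.
    have -> : a x0 t1 - ka = a x0 t1 - ka *: 1 by rewrite /GRing.scale/= mulr1.
    by apply: is_deriveB.
  by move=> s /andP[s0 st1]; apply: wm => //; apply/andP; split; lra.
have hc : c x0 t1 <= 0.
  apply: (@second_derive_le0_max R (v ^~ t1) (b ^~ t1) x0) => //.
    by move=> y y01; have [] := vd _ _ y01 t1p.
  move=> y /andP[y0 y1]; have := wm y t1 ltac:(apply/andP; split; lra) ltac:(apply/andP; split; lra).
  by rewrite lerD2r.
lra.
Qed.

(** * Finite sine series solving the heat equation *)

Definition heat_sum {R : realType} (s : seq (R * nat)) (x t : R) : R :=
  \sum_(p <- s) p.1 * expR (- ((p.2%:R * pi) ^+ 2 / 2) * t) * sin (p.2%:R * pi * x).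

Definition heat_sum_dt {R : realType} (s : seq (R * nat)) (x t : R) : R :=
  \sum_(p <- s) p.1 * (- ((p.2%:R * pi) ^+ 2 / 2) * expR (- ((p.2%:R * pi) ^+ 2 / 2) * t))
    * sin (p.2%:R * pi * x).

Definition heat_sum_dx {R : realType} (s : seq (R * nat)) (x t : R) : R :=
  \sum_(p <- s) p.1 * expR (- ((p.2%:R * pi) ^+ 2 / 2) * t) * (p.2%:R * pi * cos (p.2%:R * pi * x)).

Lemma derivable_is_derive1 {R : realType} (f : R -> R) (x : R) :
  derivable f x 1 -> is_derive x 1 f (derive1 f x).
Proof. by move=> h; split=> //; rewrite derive1E. Qed.

Lemma is_derive_sum_seq {R : realType} {I : Type} (s : seq I) (f : I -> R -> R) (df : I -> R) (x : R) :
  (forall i, is_derive x 1 (f i) (df i)) ->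
  is_derive x 1 (fun y => \sum_(i <- s) f i y) (\sum_(i <- s) df i).
Proof.
move=> h; elim: s => [|i s IH].
  rewrite big_nil (_ : (fun _ => _) = cst 0); first exact: is_derive_cst.
  by apply/funext => y; rewrite big_nil.
rewrite big_cons (_ : (fun y => _) = f i + (fun y => \sum_(j <- s) f j y)).
  exact: is_deriveD.
by apply/funext => y; rewrite big_cons.
Qed.

Lemma is_derive_comp_scale {R : realType} (f df : R -> R) (k x : R) :
  (forall y : R, is_derive y 1 f (df y)) -> is_derive x 1 (fun y => f (k * y)) (k * df (k * x)).
Proof.
move=> h; have hk : is_derive x 1 (fun y : R => k * y) k.
  apply: is_derive_eq; last by rewrite -[RHS]mulr1.
rewrite mulrC; exact: (@is_derive1_comp R f (fun y => k * y)).
Qed.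

Lemma is_derive_heat_sum_t {R : realType} (s : seq (R * nat)) (x t : R) :
  is_derive t 1 (heat_sum s x) (heat_sum_dt s x t).
Proof.
apply: is_derive_sum_seq => p.
have h := is_derive_comp_scale expR expR (- ((p.2%:R * pi) ^+ 2 / 2)) t (fun y => is_derive_expR y).
by apply: is_derive_eq; rewrite /GRing.scale/=; ring.
Qed.

Lemma is_derive_heat_sum_x {R : realType} (s : seq (R * nat)) (x t : R) :
  is_derive x 1 (heat_sum s ^~ t) (heat_sum_dx s x t).
Proof.
apply: is_derive_sum_seq => p.
have h := is_derive_comp_scale sin cos (p.2%:R * pi) x (fun y => is_derive_sin y).
by apply: is_derive_eq; rewrite /GRing.scale/=; ring.
Qed.

Lemma is_derive_heat_sum_xx {R : realType} (s : seq (R * nat)) (x t : R) :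
  is_derive x 1 (heat_sum_dx s ^~ t) (2 * heat_sum_dt s x t).
Proof.
rewrite /heat_sum_dt mulr_sumr; apply: is_derive_sum_seq => p.
have h := is_derive_comp_scale cos (fun y => - sin y) (p.2%:R * pi) x (fun y => is_derive_cos y).
apply: is_derive_eq; rewrite /GRing.scale/=.
by field.
Qed.

Lemma continuous_heat_sum {R : realType} (s : seq (R * nat)) :
  continuous (fun p : R * R => heat_sum s p.1 p.2).
Proof.
move=> q; rewrite /heat_sum; elim: s => [|[c k] s IH].
  rewrite (_ : (fun _ => _) = cst 0); first exact: cvg_cst.
  by apply/funext => p; rewrite big_nil.
rewrite (_ : (fun _ => _) = fun p : R * R =>
  c * expR (- ((k%:R * pi) ^+ 2 / 2) * p.2) * sin (k%:R * pi * p.1) +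
  \sum_(r <- s) r.1 * expR (- ((r.2%:R * pi) ^+ 2 / 2) * p.2) * sin (r.2%:R * pi * p.1)); last first.
  by apply/funext => p; rewrite big_cons.
apply: cvgD; last exact: IH.
apply: cvgM.
  apply: cvgM; first exact: cvg_cst.
  apply: continuous_comp; last exact: continuous_expR.
  by apply: cvgM; [exact: cvg_cst|exact: cvg_snd].
apply: continuous_comp; last exact: continuous_sin.
by apply: cvgM; [exact: cvg_cst|exact: cvg_fst].
Qed.

Lemma sin_nat_pi {R : realType} (k : nat) : sin (k%:R * pi) = 0 :> R.
Proof.
elim: k => [|k IH]; first by rewrite mul0r sin0.
by rewrite -natr1 mulrDl mul1r sinDpi IH oppr0.
Qed.

Lemma heat_sum_0 {R : realType} (s : seq (R * nat)) t : heat_sum s 0 t = 0.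
Proof. by rewrite /heat_sum big1// => p _; rewrite mulr0 sin0 mulr0. Qed.

Lemma heat_sum_1 {R : realType} (s : seq (R * nat)) t : heat_sum s 1 t = 0.
Proof. by rewrite /heat_sum big1// => p _; rewrite mulr1 sin_nat_pi mulr0. Qed.

(** The explicit solution has the boundary values of [phi], so the maximum principle, applied to the
    difference and to its negative, propagates the initial error. *)
Lemma heat_solution_near {R : realType} (phi0 : R -> R) (phi : R -> R -> R)
    (s : seq (R * nat)) (delta : R) :
  heat_solution phi0 phi -> 0 <= delta ->
  (forall x : R, 0 <= x <= 1 -> `|phi0 x - (phi0 1 * x + heat_sum s x 0)| <= delta) ->
  forall x t : R, 0 <= x <= 1 -> 0 <= t ->
    `|phi x t - (phi0 1 * x + heat_sum s x t)| <= delta.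
Proof.
move=> [phic [phi_0 [phib phid]]] delta0 hs.
pose psi x t := phi0 1 * x + heat_sum s x t.
have psic : continuous (fun p : R * R => psi p.1 p.2).
  move=> q; apply: cvgD; last exact: continuous_heat_sum.
  by apply: cvgM; [exact: cvg_cst|exact: cvg_fst].
have psid (x t : R) : [/\ is_derive t 1 (psi x) (heat_sum_dt s x t),
    is_derive x 1 (psi ^~ t) (phi0 1 + heat_sum_dx s x t) &
    is_derive x 1 (fun y => phi0 1 + heat_sum_dx s y t) (2 * heat_sum_dt s x t)].
  split.
  - rewrite -[heat_sum_dt _ _ _]add0r; apply: is_deriveD; exact: is_derive_heat_sum_t.
  - apply: is_deriveD; last exact: is_derive_heat_sum_x.
    apply: is_derive_eq; last by rewrite -[RHS]mulr1.
  - rewrite -[2 * _]add0r; apply: is_deriveD; exact: is_derive_heat_sum_xx.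
have phid' (x t : R) : 0 < x < 1 -> 0 < t -> [/\ is_derive t 1 (phi x) (derive1 (phi x) t),
    is_derive x 1 (phi ^~ t) (derive1 (phi ^~ t) x),
    is_derive x 1 (derive1 (phi ^~ t)) (derive1 (derive1 (phi ^~ t)) x) &
    derive1 (phi x) t = 2^-1 * derive1 (derive1 (phi ^~ t)) x].
  move=> x01 t0; have [h1 [h2 [h3 h4]]] := phid x t x01 t0.
  split; last exact: h4.
  - exact: derivable_is_derive1 h1.
  - exact: derivable_is_derive1 (h2 _ x01).
  - exact: derivable_is_derive1 h3.
have bd t : 0 < t -> phi 0 t - psi 0 t = 0 /\ phi 1 t - psi 1 t = 0.
  move=> t0; have [-> ->] := phib _ t0.
  by rewrite /psi heat_sum_0 heat_sum_1 mulr0 mulr1 !addr0 !subrr.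
move=> x t x01 t0; rewrite ler_norml; apply/andP; split.
  rewrite lerNl; move: x t x01 t0.
  apply: (@heat_max_principle R (fun x t => - (phi x t - psi x t))
    (fun x t => - (derive1 (phi x) t - heat_sum_dt s x t))
    (fun x t => - (derive1 (phi ^~ t) x - (phi0 1 + heat_sum_dx s x t)))
    (fun x t => - (derive1 (derive1 (phi ^~ t)) x - 2 * heat_sum_dt s x t)) delta).
  - have psicw := @continuous_subspaceT _ _ [set p : R * R | 0 <= p.1 <= 1 /\ 0 <= p.2] _ psic.
    by move=> p; apply: cvgN; apply: cvgB; [exact: phic|exact: psicw].
  - move=> x x01; rewrite phi_0//; have := hs x x01; rewrite ler_norml lerNl => /andP[]//.
  - by move=> t t0; have [-> ->] := bd _ t0; rewrite oppr0.
  - move=> x t x01 t0; have [p1 p2 p3] := psid x t; have [q1 q2 q3 q4] := phid' x t x01 t0.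
    split.
    + exact: is_deriveN.
    + exact: is_deriveN.
    + exact: is_deriveN.
    + rewrite q4; lra.
move: x t x01 t0.
apply: (@heat_max_principle R (fun x t => phi x t - psi x t)
    (fun x t => derive1 (phi x) t - heat_sum_dt s x t)
    (fun x t => derive1 (phi ^~ t) x - (phi0 1 + heat_sum_dx s x t))
    (fun x t => derive1 (derive1 (phi ^~ t)) x - 2 * heat_sum_dt s x t) delta).
- have psicw := @continuous_subspaceT _ _ [set p : R * R | 0 <= p.1 <= 1 /\ 0 <= p.2] _ psic.
  by move=> p; apply: cvgB; [exact: phic|exact: psicw].
- move=> x x01; rewrite phi_0//; have := hs x x01; rewrite ler_norml => /andP[]//.
- by move=> t t0; have [-> ->] := bd _ t0.
- move=> x t x01 t0; have [p1 p2 p3] := psid x t; have [q1 q2 q3 q4] := phid' x t x01 t0.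
  split.
  + exact: is_deriveB.
  + exact: is_deriveB.
  + exact: is_deriveB.
  + rewrite q4; lra.
Qed.

(** * The discrete heat equation *)

Lemma expR_taylor1 {R : realType} (k t : R) : 0 <= k -> 0 <= t <= 1 ->
  `|expR (k * t) - (1 + k * t)| <= t ^+ 2 * expR k.
Proof.
move=> k0 t01.
have := exp_dominated_taylor (fun n => k ^+ n) 1 k t t01 _ k0 ler01.
rewrite expr0 expr1 mul1r (mulrC t k) => H.
rewrite [expR (k * t)]/expR (_ : exp_coeff (k * t) = (fun n : nat => t ^+ n / n`!%:R * k ^+ n)).
  by apply: H => n; rewrite mulr1 ger0_norm ?exprn_ge0.
by apply/funext => n; rewrite /exp_coeff/= exprMn mulrAC mulrC; ring.
Qed.

Lemma expR_lipschitz {R : realType} (a b : R) : 0 <= a -> 0 <= b ->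
  `|expR (- a) - expR (- b)| <= `|a - b|.
Proof.
wlog ab : a b / a <= b => [H a0 b0|a0 b0].
  have [ab|/ltW ba] := leP a b; first exact: H.
  by rewrite distrC (distrC a); exact: H.
rewrite ger0_norm ?subr_ge0 ?ler_expR ?lerN2// distrC ger0_norm ?subr_ge0//.
have -> : - b = - a + (a - b) by lra.
rewrite expRD; have := expR_ge1Dx (a - b).
have : expR (- a) <= 1 by rewrite -expR0 ler_expR oppr_le0.
have : 0 <= expR (- a) := expR_ge0 _.
have : expR (a - b) <= 1 by rewrite -expR0 ler_expR subr_le0.
set p := expR (- a); set q := expR (a - b) => h1 h2 h3 h4.
have : p * (1 - q) <= 1 * (1 - q) by rewrite ler_wpM2r// subr_ge0.
lra.
Qed.

(** On sites y the mode sin(k pi y / L) is an eigenvector of [laplacian] for -2 (1 - cos(k pi / L)),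
    hence decays at rate 1 - cos(k pi / L) under half of it. The linear term carries the boundary
    value [e]. *)
Definition discrete_heat {R : realType} (L : nat) (e : int) (s : seq (R * nat)) (t : R) (y : nat) : R :=
  e%:~R * (y%:R / L%:R) + L%:R * \sum_(p <- s) p.1 *
    expR (- ((1 - cos (p.2%:R * pi / L%:R)) * t)) * sin (p.2%:R * pi * (y%:R / L%:R)).

Definition coef_norm {R : realType} (s : seq (R * nat)) : R := \sum_(p <- s) `|p.1|.

Lemma coef_norm_ge0 {R : realType} (s : seq (R * nat)) : 0 <= coef_norm s.
Proof. by apply: sumr_ge0. Qed.

Lemma discrete_heat0 {R : realType} L e (s : seq (R * nat)) t : discrete_heat L e s t 0 = 0.
Proof.
by rewrite /discrete_heat mul0r mulr0 add0r big1 ?mulr0// => p _; rewrite mulr0 sin0 mulr0.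
Qed.

Lemma discrete_heatL {R : realType} L e (s : seq (R * nat)) t : (0 < L)%N ->
  discrete_heat L e s t L = e%:~R.
Proof.
move=> L0; rewrite /discrete_heat divff ?pnatr_eq0 -?lt0n// mulr1 big1 ?mulr0 ?addr0// => p _.
by rewrite mulr1 sin_nat_pi mulr0.
Qed.

Lemma laplacian_discrete_heat {R : realType} L e (s : seq (R * nat)) t y :
  (0 < L)%N -> (0 < y)%N ->
  laplacian (discrete_heat L e s t) y = L%:R * \sum_(p <- s) p.1 *
    expR (- ((1 - cos (p.2%:R * pi / L%:R)) * t)) *
    (- 2 * (1 - cos (p.2%:R * pi / L%:R)) * sin (p.2%:R * pi * (y%:R / L%:R))).
Proof.
move=> L0; case: y => // y _; rewrite /laplacian /discrete_heat/=.
have Ln : L%:R != 0 :> R by rewrite pnatr_eq0 -lt0n.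
have key : \sum_(p <- s) p.1 * expR (- ((1 - cos (p.2%:R * pi / L%:R)) * t)) *
    (- 2 * (1 - cos (p.2%:R * pi / L%:R)) * sin (p.2%:R * pi * (y.+1%:R / L%:R))) =
    \sum_(p <- s) p.1 * expR (- ((1 - cos (p.2%:R * pi / L%:R)) * t)) * sin (p.2%:R * pi * (y%:R / L%:R))
  + \sum_(p <- s) p.1 * expR (- ((1 - cos (p.2%:R * pi / L%:R)) * t)) * sin (p.2%:R * pi * (y.+2%:R / L%:R))
  - 2 * \sum_(p <- s) p.1 * expR (- ((1 - cos (p.2%:R * pi / L%:R)) * t)) * sin (p.2%:R * pi * (y.+1%:R / L%:R)).
  rewrite mulr_sumr -big_split -sumrB/=; apply: eq_bigr => p _.
  have -> : p.2%:R * pi * (y%:R / L%:R) = p.2%:R * pi * (y.+1%:R / L%:R) - p.2%:R * pi / L%:R :> R.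
    by rewrite -natr1; field.
  have -> : p.2%:R * pi * (y.+2%:R / L%:R) = p.2%:R * pi * (y.+1%:R / L%:R) + p.2%:R * pi / L%:R :> R.
    by rewrite -[y.+2%:R]natr1; field.
  by rewrite sinB sinD; ring.
rewrite key -[y.+2%:R]natr1 -[y.+1%:R]natr1; field.
by [].
Qed.

(** For one mode the defect of the implicit step is exp(-lam (t + tau)) (1 + lam tau - exp(lam
    tau)); rates in [0, 2] make its constant uniform in [t]. *)
Lemma relaxation_step {R : realType} (s : seq (R * nat)) (lam sn : R * nat -> R) (t tau : R) :
  0 <= t -> 0 <= tau <= 1 -> (forall p, 0 <= lam p <= 2) -> (forall p, `|sn p| <= 1) ->
  `|\sum_(p <- s) p.1 * expR (- (lam p * (t + tau))) * sn p
    - \sum_(p <- s) p.1 * expR (- (lam p * t)) * sn p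
    - tau / 2 * \sum_(p <- s) p.1 * expR (- (lam p * (t + tau))) * (- 2 * lam p * sn p)| <=
  coef_norm s * expR 2 * tau ^+ 2.
Proof.
move=> t0 /andP[tau0 tau1] lam02 sn1.
have <- : \sum_(p <- s) p.1 * (expR (- (lam p * (t + tau))) * (1 + lam p * tau - expR (lam p * tau))) * sn p
    = \sum_(p <- s) p.1 * expR (- (lam p * (t + tau))) * sn p
      - \sum_(p <- s) p.1 * expR (- (lam p * t)) * sn p
      - tau / 2 * \sum_(p <- s) p.1 * expR (- (lam p * (t + tau))) * (- 2 * lam p * sn p).
  rewrite mulr_sumr -!sumrB; apply: eq_bigr => p _.
  have -> : - (lam p * t) = - (lam p * (t + tau)) + lam p * tau by ring.
  by rewrite expRD; field.
apply: le_trans (ler_norm_sum _ _ _) _; rewrite /coef_norm -mulrA mulr_suml.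
apply: ler_sum => p _; rewrite !normrM -!mulrA ler_wpM2l//.
have /andP[l0 l2] := lam02 p.
have h1 : `|expR (- (lam p * (t + tau)))| <= 1.
  by rewrite ger0_norm ?expR_ge0// -expR0 ler_expR oppr_le0 mulr_ge0// addr_ge0.
have h2 : `|1 + lam p * tau - expR (lam p * tau)| <= expR 2 * tau ^+ 2.
  rewrite distrC [leRHS]mulrC; apply: le_trans (expR_taylor1 _ _ l0 _) _; first by rewrite tau0.
  by rewrite ler_wpM2l ?sqr_ge0// ler_expR.
rewrite mulrA -[leRHS]mulr1 ler_pM//.
by rewrite -[leRHS]mul1r ler_pM.
Qed.

Lemma discrete_heat_step {R : realType} L e (s : seq (R * nat)) (t tau : R) y :
  (0 < L)%N -> (0 < y < L)%N -> 0 <= t -> 0 <= tau <= 1 ->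
  `|discrete_heat L e s (t + tau) y - discrete_heat L e s t y
    - tau / 2 * laplacian (discrete_heat L e s (t + tau)) y| <=
  L%:R * (coef_norm s * expR 2) * tau ^+ 2.
Proof.
move=> L0 /andP[y0 _] t0 tau01; rewrite laplacian_discrete_heat// /discrete_heat.
have := relaxation_step s (fun p => 1 - cos (p.2%:R * pi / L%:R))
  (fun p => sin (p.2%:R * pi * (y%:R / L%:R))) t tau t0 tau01 _ (fun p => sin_max _).
move=> /(_ _) H.
have -> : forall A B C D : R, D + L%:R * A - (D + L%:R * B) - tau / 2 * (L%:R * C) =
  L%:R * (A - B - tau / 2 * C) by move=> A B C D; ring.
rewrite normrM ger0_norm// -[leRHS]mulrA ler_wpM2l//; apply: H => p.
rewrite subr_ge0 cos_le1/=; have := cos_geN1 (p.2%:R * pi / L%:R : R); lra.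
Qed.

Lemma discrete_heat_bound {R : realType} L e (s : seq (R * nat)) (t : R) y :
  (0 < y < L)%N -> `|e| <= L%:Z -> 0 <= t ->
  `|discrete_heat L e s t y| <= L%:R * (1 + coef_norm s).
Proof.
move=> yL eL t0; rewrite /discrete_heat mulrDr mulr1.
have L0 : 0 < L%:R :> R by rewrite ltr0n; lia.
apply: le_trans (ler_normD _ _) _; apply: lerD.
  rewrite normrM -[leRHS]mulr1; apply: ler_pM => //.
    by rewrite -intr_norm -[L%:R]/(L%:Z%:~R) ler_int.
  by rewrite ger0_norm ?divr_ge0// ler_pdivrMr// mul1r ler_nat; lia.
rewrite normrM ger0_norm// ler_wpM2l//.
apply: le_trans (ler_norm_sum _ _ _) _; apply: ler_sum => p _.
rewrite !normrM -mulrA -[leRHS]mulr1 ler_wpM2l// -[leRHS]mulr1 ler_pM//; last exact: sin_max.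
rewrite ger0_norm ?expR_ge0// -expR0 ler_expR oppr_le0 mulr_ge0// subr_ge0; exact: cos_le1.
Qed.

(** With w = k pi / (2 L) the two terms are 2 L^2 sin(w)^2 and 2 L^2 w^2, and w - sin w <= w (1 -
    cos w) <= w^2. The condition k <= L keeps w below pi / 2. *)
Lemma discrete_eigenvalue {R : realType} (L k : nat) : (0 < L)%N -> (k <= L)%N ->
  `|(1 - cos (k%:R * pi / L%:R)) * L%:R ^+ 2 - (k%:R * pi) ^+ 2 / 2| <=
  (k%:R * pi) ^+ 3 / 2 / L%:R :> R.
Proof.
move=> L0 kL; have Lp : 0 < L%:R :> R by rewrite ltr0n.
set q : R := k%:R * pi; pose w := q / (2 * L%:R).
have q0 : 0 <= q by rewrite mulr_ge0// pi_ge0.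
have w0 : 0 <= w by rewrite divr_ge0// mulr_ge0.
have wp : w <= pi / 2.
  rewrite /w ler_pdivrMr ?mulr_gt0// (_ : pi / 2 * (2 * L%:R) = L%:R * pi); last by field.
  by rewrite /q ler_wpM2r ?pi_ge0// ler_nat.
have qE : q / L%:R = w *+ 2 by rewrite /w mulr2n; field; rewrite gt_eqF.
rewrite qE cos_mulr2n -mulr_natl cos2sin2.
have h1 := sin_ge_mul_cos w ltac:(by rewrite w0).
have h2 : sin w <= w.
  by have := sin_lipschitz w 0; rewrite sin0 !subr0 (ger0_norm w0); apply: le_trans; exact: ler_norm.
have s0 : 0 <= sin w.
  have := sin_ge_half w ltac:(by rewrite w0); lra.
have h3 : 1 - cos w <= w.
  have -> : cos w = sin (w + pi / 2) by rewrite sinDpihalf.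
  have := sin_lipschitz (pi / 2) (w + pi / 2).
  rewrite sin_pihalf opprD addrCA subrr addr0 normrN (ger0_norm w0); apply: le_trans; exact: ler_norm.
have h4 : w - sin w <= w * w by have := ler_wpM2l w0 h3; lra.
have -> : (1 - (2 * (1 - sin w ^+ 2) - 1)) * L%:R ^+ 2 - q ^+ 2 / 2 =
   - (2 * L%:R ^+ 2 * ((w - sin w) * (w + sin w))).
  by rewrite /w; field; rewrite gt_eqF.
have -> : q ^+ 3 / 2 / L%:R = 2 * L%:R ^+ 2 * ((w * w) * (w + w)).
  by rewrite /w; field; rewrite gt_eqF.
have d0 : 0 <= w - sin w by rewrite subr_ge0.
have d1 : 0 <= w + sin w by rewrite addr_ge0.
have d2 : 0 <= 2 * L%:R ^+ 2 :> R by rewrite mulr_ge0// exprn_ge0.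
rewrite normrN ger0_norm; last by rewrite !mulr_ge0.
by rewrite ler_wpM2l// ler_pM// lerD2l.
Qed.

(** The decay rates put the modes off by order 1 / L, hence by [C] after multiplication by L; the 2
    is the rounding of the endpoint. [N] is at least every mode, as [discrete_eigenvalue]
    requires. *)
Lemma discrete_heat_near {R : realType} (s : seq (R * nat)) (T : R) : 0 <= T ->
  exists (C : R) (N : nat), forall L (e : int) (m t : R) y,
    (0 < L)%N -> (N <= L)%N -> (y <= L)%N -> 0 <= t <= L%:R ^+ 2 * T -> `|e%:~R - L%:R * m| <= 2 ->
    `|discrete_heat L e s t y - L%:R * (m * (y%:R / L%:R) + heat_sum s (y%:R / L%:R) (t / L%:R ^+ 2))|
    <= 2 + C.
Proof.
move=> T0.
have [C [N HC]] : exists (C : R) (N : nat), forall L t z, (0 < L)%N -> (N <= L)%N ->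
    0 <= t <= L%:R ^+ 2 * T ->
    `|\sum_(p <- s) p.1 * expR (- ((1 - cos (p.2%:R * pi / L%:R)) * t)) * sin (p.2%:R * pi * z)
      - heat_sum s z (t / L%:R ^+ 2)| <= C / L%:R.
  rewrite /heat_sum; elim: s => [|[c k] s [C [N HC]]].
    by exists 0, 0%N => L t z _ _ _; rewrite !big_nil subrr normr0 mul0r.
  exists (`|c| * (T * ((k%:R * pi) ^+ 3 / 2)) + C), (maxn N k) => L t z L0.
  rewrite geq_max => /andP[NL kL] tT; rewrite !big_cons/= opprD addrACA.
  apply: le_trans (ler_normD _ _) _; rewrite [leRHS]mulrDl; apply: lerD; last exact: HC.
  have Lp : 0 < L%:R :> R by rewrite ltr0n.
  have tT' : 0 <= t / L%:R ^+ 2 <= T.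
    case/andP: tT => t0 t1; rewrite divr_ge0 ?exprn_ge0//= ler_pdivrMr ?exprn_gt0//.
    by rewrite mulrC.
  set t' := t / _ in tT' *; have tE : t = L%:R ^+ 2 * t' by rewrite /t' mulrC divfK// expf_neq0// gt_eqF.
  case/andP: tT' => t'0 t'T.
  rewrite -mulrBl -mulrBr !normrM mulNr.
  apply: (@le_trans _ _ (`|c| * (T * ((k%:R * pi) ^+ 3 / 2) / L%:R) * 1)); last first.
    by rewrite mulr1 -[leRHS]mulrA.
  rewrite ler_pM ?mulr_ge0 ?sin_max// ler_wpM2l//.
  apply: le_trans (expR_lipschitz _ _ _ _) _.
  - by rewrite mulr_ge0// ?subr_ge0 ?cos_le1//; case/andP: tT.
  - by rewrite mulr_ge0// divr_ge0// sqr_ge0.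
  rewrite tE [(1 - _) * (_ * _)]mulrA -mulrBl normrM (ger0_norm t'0) [leLHS]mulrC -[leRHS]mulrA.
  by apply: ler_pM => //; exact: discrete_eigenvalue.
exists C, N => L e m t y L0 NL yL tT em; have Lp : 0 < L%:R :> R by rewrite ltr0n.
rewrite /discrete_heat mulrDr opprD addrACA.
apply: le_trans (ler_normD _ _) _; apply: lerD.
  rewrite mulrA -mulrBl normrM -[leRHS]mulr1 ler_pM//.
  by rewrite ger0_norm ?divr_ge0// ler_pdivrMr// mul1r ler_nat.
by rewrite -mulrBr normrM ger0_norm// -ler_pdivlMl// [leRHS]mulrC; exact: HC.
Qed.

(** * The rounded initial profile *)

Lemma init_height_near {R : realType} (phi0 : R -> R) (L x : nat) :
  (init_height phi0 L x)%:~R <= L%:R * phi0 (x%:R / L%:R) < (init_height phi0 L x)%:~R + 2.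
Proof.
rewrite /init_height; set v := L%:R * _.
case: (odd x).
  have /andP[] := floor_itv ((v - 1) / 2).
  rewrite !intrD intrM/= => h1 h2; apply/andP; split; lra.
have /andP[] := floor_itv (v / 2).
rewrite !intrD intrM/= => h1 h2; apply/andP; split; lra.
Qed.

Lemma init_height_odd {R : realType} (phi0 : R -> R) (L x : nat) :
  exists k : int, init_height phi0 L x = 2 * k + (odd x)%:R.
Proof.
rewrite /init_height; case: (odd x).
  by exists (Num.floor ((L%:R * phi0 (x%:R / L%:R) - 1) / 2)).
by exists (Num.floor (L%:R * phi0 (x%:R / L%:R) / 2)); rewrite addr0.
Qed.

(** Rounding errors lie in [0, 2) and L phi0 moves by at most 1 per site, so an increment lies
    strictly between -3 and 3; by parity it is odd, hence 1 or -1. *)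
Lemma init_profile_admissible {R : realType} (phi0 : R -> R) (L : nat) : (0 < L)%N ->
  lipschitz1_01 phi0 -> phi0 0 = 0 ->
  admissible L (init_height phi0 L L) (init_profile phi0 L).
Proof.
move=> L0 lip p0; have Lp : 0 < L%:R :> R by rewrite ltr0n.
split.
- by rewrite size_mkseq.
- by rewrite nth_mkseq// /init_height/= mul0r p0 mulr0 mul0r floor0.
- by rewrite nth_mkseq.
move=> x xL; rewrite !nth_mkseq ?ltnS// 1?ltnW//.
have /andP[a1 a2] := init_height_near phi0 L x.
have /andP[b1 b2] := init_height_near phi0 L x.+1.
have := lip (x.+1%:R / L%:R) (x%:R / L%:R).
rewrite !divr_ge0//= !ler_pdivrMr// !mul1r !ler_nat xL (ltnW xL) => /(_ isT isT).
rewrite -mulrBl -natrB// subSnn mul1r (ger0_norm (_ : 0 <= L%:R^-1)) ?invr_ge0// => hl.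
have {}hl : `|L%:R * phi0 (x.+1%:R / L%:R) - L%:R * phi0 (x%:R / L%:R)| <= 1.
  by rewrite -mulrBr normrM ger0_norm// -ler_pdivlMl// mulr1.
move: hl; rewrite ler_norml => /andP[l1 l2].
have [k hk] := init_height_odd phi0 L x; have [k' hk'] := init_height_odd phi0 L x.+1.
set u := init_height _ _ _ in hk b1 b2 a1 a2 *; set v := init_height _ _ _ in hk' b1 b2 a1 a2 *.
have h1 : v%:~R < (u + 3)%:~R :> R by rewrite intrD/=; lra.
have h2 : (u - 3)%:~R < v%:~R :> R by rewrite intrD/=; lra.
rewrite ltr_int in h1; rewrite ltr_int in h2.
by move: hk hk' h1 h2; rewrite /=; case: (odd x) => /=; lia.
Qed.

(** * Convergence *)

Lemma heat_sum_lipschitz {R : realType} (s : seq (R * nat)) :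
  exists2 K : R, 0 <= K & forall x z t r : R, 0 <= t -> 0 <= r ->
    `|heat_sum s x t - heat_sum s z r| <= K * (`|x - z| + `|t - r|).
Proof.
rewrite /heat_sum; elim: s => [|[c k] s [K K0 HK]].
  by exists 0 => // x z t r _ _; rewrite !big_nil subrr normr0 mul0r.
set q : R := k%:R * pi; have q0 : 0 <= q by rewrite mulr_ge0// pi_ge0.
have Q0 : 0 <= q + q ^+ 2 / 2 by rewrite addr_ge0// divr_ge0// sqr_ge0.
exists (`|c| * (q + q ^+ 2 / 2) + K); first by rewrite addr_ge0// mulr_ge0.
move=> x z t r t0 r0; rewrite !big_cons/= opprD addrACA [leRHS]mulrDl.
apply: le_trans (ler_normD _ _) _; apply: lerD; last exact: HK.
rewrite -/q.
have -> : c * expR (- (q ^+ 2 / 2) * t) * sin (q * x) - c * expR (- (q ^+ 2 / 2) * r) * sin (q * z) =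
  c * ((expR (- (q ^+ 2 / 2) * t) - expR (- (q ^+ 2 / 2) * r)) * sin (q * x) +
  expR (- (q ^+ 2 / 2) * r) * (sin (q * x) - sin (q * z))) by ring.
rewrite normrM -[leRHS]mulrA ler_wpM2l//; apply: le_trans (ler_normD _ _) _; rewrite !normrM.
have Q1 : 0 <= q ^+ 2 / 2 by rewrite divr_ge0// sqr_ge0.
have h1 : `|expR (- (q ^+ 2 / 2) * t) - expR (- (q ^+ 2 / 2) * r)| <= q ^+ 2 / 2 * `|t - r|.
  rewrite !mulNr; apply: le_trans (expR_lipschitz _ _ (mulr_ge0 Q1 t0) (mulr_ge0 Q1 r0)) _.
  by rewrite -mulrBr normrM (ger0_norm Q1).
have h2 := sin_lipschitz (q * x) (q * z); rewrite -mulrBr normrM (ger0_norm q0) in h2.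
have h3 : `|expR (- (q ^+ 2 / 2) * r)| <= 1.
  rewrite ger0_norm ?expR_ge0// -[leRHS]expR0 ler_expR mulNr oppr_le0.
  exact: mulr_ge0.
have h4 := ler_pM (normr_ge0 _) (normr_ge0 _) h1 (sin_max (q * x)).
have h5 := ler_pM (normr_ge0 _) (normr_ge0 _) h3 h2.
have h6 : 0 <= q * `|t - r| by rewrite mulr_ge0.
have h7 : 0 <= q ^+ 2 / 2 * `|x - z| by rewrite mulr_ge0.
lra.
Qed.

Lemma heat_sum_init {R : realType} (s : seq (R * nat)) x : heat_sum s x 0 = sine_sum s x.
Proof. by apply: eq_bigr => p _; rewrite mulr0 expR0 mulr1. Qed.

Lemma heat_sum_approx {R : realType} (phi0 : R -> R) (phi : R -> R -> R) (delta : R) :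
  lipschitz1_01 phi0 -> phi0 0 = 0 -> heat_solution phi0 phi -> 0 < delta ->
  exists s, forall x t : R, 0 <= x <= 1 -> 0 <= t ->
    `|phi x t - (phi0 1 * x + heat_sum s x t)| <= delta.
Proof.
move=> lip p0 hphi d0.
have p1 : `|phi0 1| <= 1.
  by have := lip 1 0; rewrite p0 !subr0 normr1; apply; rewrite ?lexx ler01.
(* The linear part has slope at most 1 in absolute value, whence the Lipschitz constant 2. *)
have [] := sine_sum_approx (fun x => phi0 x - phi0 1 * x) delta => //.
- move=> x y x01 y01.
  have -> : phi0 x - phi0 1 * x - (phi0 y - phi0 1 * y) = (phi0 x - phi0 y) - phi0 1 * (x - y) by ring.
  apply: le_trans (ler_normB _ _) _; rewrite normrM.
  have := lip x y x01 y01; have := ler_wpM2r (normr_ge0 (x - y)) p1; lra.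
- by rewrite p0 mulr0 subrr.
- by rewrite mulr1 subrr.
move=> s hs; exists s; apply: heat_solution_near hphi (ltW d0) _ => x x01.
by rewrite heat_sum_init opprD addrA; exact: hs.
Qed.

(** Read off from a sine-sum approximation, which makes the modulus uniform over all times,
    including down to t = 0; [K] depends on [eps]. *)
Lemma heat_solution_modulus {R : realType} (phi0 : R -> R) (phi : R -> R -> R) (eps : R) :
  lipschitz1_01 phi0 -> phi0 0 = 0 -> heat_solution phi0 phi -> 0 < eps ->
  exists2 K : R, 1 <= K & forall x z t r : R, 0 <= x <= 1 -> 0 <= z <= 1 -> 0 <= t -> 0 <= r ->
    `|phi x t - phi z r| <= eps + K * (`|x - z| + `|t - r|).
Proof.
move=> lip p0 hphi e0.
have [s hs] := heat_sum_approx phi0 phi (eps / 2) lip p0 hphi ltac:(by rewrite divr_gt0).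
have [K K0 HK] := heat_sum_lipschitz s.
exists (K + 1); first by rewrite lerDr.
have p1 : `|phi0 1| <= 1.
  by have := lip 1 0; rewrite p0 !subr0 normr1; apply; rewrite ?lexx ler01.
move=> x z t r x01 z01 t0 r0.
have h1 := hs x t x01 t0; have h2 := hs z r z01 r0; have h3 := HK x z t r t0 r0.
have h4 := ler_wpM2r (normr_ge0 (x - z)) p1; rewrite -normrM in h4.
have -> : phi x t - phi z r = (phi x t - (phi0 1 * x + heat_sum s x t))
  - (phi z r - (phi0 1 * z + heat_sum s z r)) + phi0 1 * (x - z) + (heat_sum s x t - heat_sum s z r) by ring.
apply: le_trans (ler_normD _ _) _; apply: le_trans (lerD (ler_normD _ _) (lexx _)) _.
apply: le_trans (lerD (lerD (ler_normB _ _) (lexx _)) (lexx _)) _.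
have := normr_ge0 (t - r); lra.
Qed.

Lemma nat_large {R : realType} (z : R) : exists N, forall n, (N <= n)%N -> z <= n%:R.
Proof.
exists (Num.bound `|z|) => n Nn; apply: le_trans (ler_norm z) _; apply/ltW.
by apply: lt_le_trans (archi_boundP _) _; rewrite ?ler_nat.
Qed.

Lemma natr_dist_le {R : realType} (x y w : nat) : (x <= y + w)%N -> (y <= x + w)%N ->
  `|y%:R - x%:R| <= w%:R :> R.
Proof.
move=> xy yx; rewrite ler_distl lerBlDr -!natrD !ler_nat.
by rewrite xy yx.
Qed.

(* A deviation of order [L] at one site persists over a range of order [L],
   because [a] is 1-Lipschitz and [m] is equicontinuous up to [eps / 8]. *)
Lemma energy_sup {R : realType} (L : nat) e (u m : nat -> R) a (eps K rho : R) :
  (0 < L)%N -> admissible L e a -> u 0%N = 0 -> u L = e%:~R ->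
  0 < eps -> 1 <= K -> rho = eps / (16 * K) -> 2 / rho <= L%:R ->
  (forall y, (y <= L)%N -> `|u y - L%:R * m y| <= L%:R * (eps / 16)) ->
  (forall x y, (x <= L)%N -> (y <= L)%N ->
     `|m x - m y| <= eps / 8 + K * `|x%:R / L%:R - y%:R / L%:R|) ->
  energy L u a <= eps ^+ 2 * rho ^+ 4 / 64 / 128 * L%:R ^+ 5 ->
  forall x, (x <= L)%N -> `|deviation u a x| <= L%:R * (eps / 2).
Proof.
move=> L0 va u0 uL eps0 K1 rhoE rhoL um mK en x xL.
have Lp : 0 < L%:R :> R by rewrite ltr0n.
have Kp : 0 < K by lra.
have rho0 : 0 < rho by rewrite rhoE divr_gt0// mulr_gt0.
have rho1 : K * rho <= eps / 16 by rewrite rhoE le_eqVlt; apply/orP; left; apply/eqP; field; rewrite gt_eqF.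
have rho2 : rho <= eps / 16 by apply: le_trans rho1; rewrite -[leLHS]mul1r ler_wpM2r// ltW.
(* Over a range rho L both the variation of [a], divided by L, and the term [K * rho] are at most
   eps / 16; L >= 2 / rho keeps half of the range after rounding. *)
pose w := Num.truncn (rho * L%:R).
have w1 : w%:R <= rho * L%:R by rewrite truncn_le// mulr_ge0// ltW.
have w2 : rho * L%:R / 2 <= w%:R.
  have : rho * L%:R < w.+1%:R by exact: truncnS_gt.
  rewrite -natr1; have : 2 <= rho * L%:R by rewrite mulrC -ler_pdivrMr.
  by clear; lra.
(* [sg] is the sign of the deviation, so both signs are treated at once. *)
have core (sg : R) : sg ^+ 2 = 1 -> L%:R * (eps / 2) < sg * deviation u a x -> False.
  move=> sg1 hx.
  have sgn : `|sg| = 1.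
    by apply/eqP; rewrite -(@eqrXn2 _ 2)// ?expr1n ?real_normK ?num_real// sg1.
  have fE : hdot L (fun y => sg * deviation u a y) (fun y => sg * deviation u a y) = energy L u a.
    by rewrite hdotZr hdotC hdotZr mulrA -expr2 sg1 mul1r.
  have c0 : 0 < L%:R * (eps / 8) by rewrite mulr_gt0// divr_gt0.
  have := hdot_bump L (fun y => sg * deviation u a y) x w (L%:R * (eps / 8)) L0 c0 _ _ xL _.
  rewrite fE => /(_ _ _ _) H.
  have {}H : (L%:R * (eps / 8) * w%:R ^+ 2 / 2) ^+ 2 <= L%:R * energy L u a.
    apply: H.
    - by rewrite /deviation u0; case: va => _ -> _ _; rewrite subrr mulr0.
    - by rewrite /deviation uL; case: va => _ _ -> _; rewrite subrr mulr0.
    move=> y yL yw1 yw2.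
    have d1 : `|y%:R - x%:R| <= w%:R :> R by exact: natr_dist_le (ltnW yw1) (ltnW yw2).
    have d2 : `|(nth 0 a y)%:~R - (nth 0 a x)%:~R| <= `|y%:R - x%:R| :> R.
      rewrite -intrB -intr_norm -[y%:R]/(y%:Z%:~R) -[x%:R]/(x%:Z%:~R) -intrB -intr_norm ler_int.
      exact: admissible_lip va yL xL.
    have d3 : `|m y - m x| <= eps / 8 + eps / 16.
      apply: le_trans (mK y x yL xL) _; rewrite lerD2l; apply: le_trans rho1.
      rewrite ler_wpM2l ?(ltW Kp)// -mulrBl normrM normfV (gtr0_norm Lp) ler_pdivrMr//.
      exact: le_trans d1 w1.
    (* In units of L eps / 16: 1 from [a], 1 + 1 from [u] against [m], 3 from [m]. Of the 8 at [x],
       at least 2 remain at [y]. *)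
    have d4 : `|deviation u a y - deviation u a x| <= L%:R * (eps * 6 / 16).
      have -> : deviation u a y - deviation u a x =
         ((nth 0 a y)%:~R - (nth 0 a x)%:~R) - (u y - L%:R * m y) + (u x - L%:R * m x)
         - L%:R * (m y - m x) by rewrite /deviation; ring.
      apply: le_trans (ler_normB _ _) _; rewrite normrM (gtr0_norm Lp).
      apply: le_trans (lerD (ler_normD _ _) (lexx _)) _.
      apply: le_trans (lerD (lerD (ler_normB _ _) (lexx _)) (lexx _)) _.
      have d5 := le_trans (le_trans d2 d1) (le_trans w1 (ler_wpM2r (ltW Lp) rho2)).
      move: (um y yL) (um x xL) (ler_wpM2l (ltW Lp) d3) d5; clear; lra.
    have d5 : `|sg * (deviation u a y - deviation u a x)| <= L%:R * (eps * 6 / 16).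
      by rewrite normrM sgn mul1r.
    move: d5; rewrite mulrBr ler_norml => /andP[d5 _]; move: d5 hx; clear; lra.
  have w3 : (rho * L%:R / 2) ^+ 2 <= w%:R ^+ 2.
    by rewrite lerXn2r ?nnegrE// divr_ge0// mulr_ge0// ltW.
  have w4 : L%:R * (eps / 8) * (rho * L%:R / 2) ^+ 2 / 2 <= L%:R * (eps / 8) * w%:R ^+ 2 / 2.
    by rewrite ler_wpM2r// ler_wpM2l// ltW.
  have w5 : 0 <= L%:R * (eps / 8) * (rho * L%:R / 2) ^+ 2 / 2.
    by rewrite divr_ge0// mulr_ge0// ?sqr_ge0// ltW.
  have w6 : (L%:R * (eps / 8) * (rho * L%:R / 2) ^+ 2 / 2) ^+ 2 <= (L%:R * (eps / 8) * w%:R ^+ 2 / 2) ^+ 2.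
    by rewrite lerXn2r ?nnegrE//; exact: le_trans w5 w4.
  have w7 : L%:R * energy L u a <= L%:R * (eps ^+ 2 * rho ^+ 4 / 64 / 128 * L%:R ^+ 5) by rewrite ler_wpM2l.
  have w8 : 0 < eps ^+ 2 * rho ^+ 4 * L%:R ^+ 6 by rewrite !mulr_gt0// exprn_gt0.
  move: (le_trans w6 (le_trans H w7)) w8; set X := _ * _ * L%:R ^+ 6.
  (* The bump forces X / 64 / 64, twice what the energy bound allows. *)
  have -> : (L%:R * (eps / 8) * (rho * L%:R / 2) ^+ 2 / 2) ^+ 2 = X / 64 / 64 by rewrite /X; field.
  have -> : L%:R * (eps ^+ 2 * rho ^+ 4 / 64 / 128 * L%:R ^+ 5) = X / 64 / 128 by rewrite /X; field.
  by clear; lra.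
rewrite leNgt; apply/negP => hx.
have [d0|d0] := leP 0 (deviation u a x).
  by apply: (core 1); [rewrite expr1n|rewrite mul1r -(ger0_norm d0)].
by apply: (core (-1)); [rewrite sqrrN expr1n|rewrite mulN1r -(ltr0_norm d0)].
Qed.

Theorem theorem3p1 (R : realType) (phi0 : R -> R) (phi : R -> R -> R)
  (d : measure_display) (Om : nat -> measurableType d)
  (P : forall L : nat, probability (Om L) R)
  (h : forall L : nat, Om L -> R -> seq int) :
  lipschitz1_01 phi0 -> phi0 0 = 0 ->
  heat_solution phi0 phi ->
  (forall L : nat, corner_flip_process (P L) L (init_profile phi0 L) (h L)) ->
  forall T eps : R, 0 <= T -> 0 < eps ->
  forall eta : R, 0 < eta ->
  exists L0 : nat, forall L : nat, (L0 <= L)%N ->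
    exists2 G : set (Om L), measurable G /\ ((1 - eta)%:E <= P L G)%E &
      forall w, G w ->
        forall t x : R, 0 <= t <= T -> 0 <= x <= 1 ->
          `| (nth 0 (h L w (L%:R ^+ 2 * t)) (Num.truncn (x * L%:R)))%:~R
             - L%:R * phi x t | / L%:R <= eps.
Proof.
move=> lip p0 hphi proc T eps T0 eps0 eta eta0.
have e8 : 0 < eps / 8 by rewrite divr_gt0.
have [K K1 HK] := heat_solution_modulus phi0 phi (eps / 8) lip p0 hphi e8.
have Kp : 0 < K by exact: lt_le_trans K1.
pose rho := eps / (16 * K); have rho0 : 0 < rho by rewrite divr_gt0// mulr_gt0.
(* The threshold of [energy_sup] in units of L^5. *)
pose kap := eps ^+ 2 * rho ^+ 4 / 64 / 128.
have kap0 : 0 < kap by rewrite !divr_gt0// mulr_gt0// exprn_gt0.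
have ke0 : 0 < kap * eta by rewrite mulr_gt0.
(* In turn: delta^2 <= delta, an initial energy within half of the budget, an approximation error of
   at most eps / 32. *)
pose delta := Num.min 1 (Num.min (kap * eta / 8) (eps / 32)).
have delta0 : 0 < delta by rewrite !lt_min ltr01 !divr_gt0.
have delta1 : delta <= 1 by rewrite ge_min lexx.
have delta2 : delta <= kap * eta / 8 by rewrite !ge_min lexx !orbT.
have delta3 : delta <= eps / 32 by rewrite !ge_min lexx !orbT.
have [s hs] := heat_sum_approx phi0 phi delta lip p0 hphi delta0.
(* One extra unit of horizon, since [path_bound] covers times strictly before its end. *)
have T1 : 0 <= T + 1 by rewrite addr_ge0.
have [C [N HC]] := discrete_heat_near s (T + 1) T1.
(* [N1] absorbs rounding and [C] into L delta, [N2] the noise into the budget; [N3] brings the error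
   of the discrete solution to eps / 16, [N4] leaves room for the bump, [N5] covers the shift to
   nearby sites and times. *)
have [N1 HN1] := nat_large ((4 + C) / delta).
have [N2 HN2] := nat_large (4 * (T + 1) / (kap * eta)).
have [N3 HN3] := nat_large (32 * (2 + C) / eps).
have [N4 HN4] := nat_large (2 / rho).
have [N5 HN5] := nat_large (32 * K / eps).
exists (N + N1 + N2 + N3 + N4 + N5).+1 => L LL.
have L0 : (0 < L)%N by apply: leq_trans LL.
have NL : (N <= L)%N by move: LL; clear; lia.
have {HN1} l1 : (4 + C) / delta <= L%:R by apply: HN1; move: LL; clear; lia.
have {HN2} l2 : 4 * (T + 1) / (kap * eta) <= L%:R by apply: HN2; move: LL; clear; lia.
have {HN3} l3 : 32 * (2 + C) / eps <= L%:R by apply: HN3; move: LL; clear; lia.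
have {HN4} l4 : 2 / rho <= L%:R by apply: HN4; move: LL; clear; lia.
have {HN5} l5 : 32 * K / eps <= L%:R by apply: HN5; move: LL; clear; lia.
rewrite ler_pdivrMr// in l1; rewrite ler_pdivrMr// in l2.
rewrite ler_pdivrMr// in l3; rewrite ler_pdivrMr// in l5.
have Lp : 0 < L%:R :> R by rewrite ltr0n.
have L1 : 1 <= L%:R :> R by rewrite ler1n.
pose e := init_height phi0 L L.
have va := init_profile_admissible phi0 L L0 lip p0.
have eL : `|e| <= L%:Z.
  by have := admissible_bound L e _ L va; case: (va) => _ _ -> _.
have em : `|e%:~R - L%:R * phi0 1| <= 2.
  have := init_height_near phi0 L L; rewrite divff ?gt_eqF// -/e => /andP[m1 m2].
  by rewrite ler_norml; apply/andP; split; move: m1 m2; clear; lra.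
have frac y : (y <= L)%N -> 0 <= (y%:R / L%:R : R) <= 1.
  by move=> yL; rewrite divr_ge0//= ler_pdivrMr// mul1r ler_nat.
have near_phi r y : (y <= L)%N -> 0 <= r <= L%:R ^+ 2 * (T + 1) ->
    `|discrete_heat L e s r y - L%:R * phi (y%:R / L%:R) (r / L%:R ^+ 2)| <= 2 + C + L%:R * delta.
  move=> yL rT; have q1 := HC L e (phi0 1) r y L0 NL yL rT em.
  have r0 : 0 <= r / L%:R ^+ 2 by case/andP: rT => r0 _; rewrite divr_ge0// exprn_ge0.
  have q2 := ler_wpM2l (ltW Lp) (hs _ _ (frac y yL) r0).
  rewrite -[X in X * `|_|](gtr0_norm Lp) -normrM in q2.
  move: q1 q2; set A := discrete_heat _ _ _ _ _; set B := phi _ _; set D := _ + heat_sum _ _ _.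
  move=> q1 q2; have -> : A - L%:R * B = (A - L%:R * D) - (L%:R * (B - D)) by ring.
  by apply: le_trans (ler_normB _ _) _; rewrite lerD.
pose lam := kap * L%:R ^+ 5; have lam0 : 0 < lam by rewrite mulr_gt0// exprn_gt0.
have L2p : 0 < L%:R ^+ 2 :> R by rewrite exprn_gt0.
have [G [mG PG] HG] := path_bound (P L) L e (init_profile phi0 L) (h L)
  (fun t y => discrete_heat L e s t y) (L%:R ^+ 2 * (T + 1)) (L%:R * (1 + coef_norm s))
  (L%:R * (coef_norm s * expR 2)) lam L0 va (proc L)
  ltac:(by rewrite mulr_gt0// ltr_wpDl) lam0
  ltac:(by rewrite mulr_ge0// addr_ge0// coef_norm_ge0)
  ltac:(by rewrite mulr_ge0// mulr_ge0 ?coef_norm_ge0// expR_ge0)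
  (fun t => discrete_heat0 L e s t) (fun t => discrete_heatL L e s t L0)
  (fun t y t0 yL => discrete_heat_bound L e s t y yL eL t0)
  (fun t tau y t0 tau01 yL => discrete_heat_step L e s t tau y L0 yL t0 tau01).
exists G; first split => //.
  (* The initial energy is at most 4 delta^2 L^5 and the noise 2 (T + 1) L^4; each takes at most
     half of [eta * lam]. *)
  apply: le_trans PG; rewrite lee_fin lerD2l lerN2 ler_pdivrMr//.
  have dev0 y : (0 < y < L)%N ->
      `|deviation (discrete_heat L e s 0) (init_profile phi0 L) y| <= 2 * (L%:R * delta).
    move=> /andP[_ /ltnW yL]; rewrite /deviation nth_mkseq ?ltnS//.
    have := near_phi 0 y yL ltac:(by rewrite lexx mulr_ge0// ltW).
    have phi00 : phi (y%:R / L%:R) 0 = phi0 (y%:R / L%:R).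
      by case: (hphi) => _ [H _]; apply: H; exact: frac.
    rewrite mul0r phi00.
    have /andP[] := init_height_near phi0 L y.
    set A := (init_height _ _ _)%:~R; set B := L%:R * phi0 _; set D := discrete_heat _ _ _ _ _.
    rewrite !ler_norml => a1 a2 /andP[a3 a4].
    by move: l1 a1 a2 a3 a4; clear; move=> *; apply/andP; split; lra.
  have dL : 0 <= 2 * (L%:R * delta) by rewrite mulr_ge0// mulr_ge0// ltW.
  have := hdot_bound L _ _ _ _ dev0 dL dev0 dL.
  rewrite ger0_norm ?hdot_ge0// -/(energy _ _ _) => hen.
  have d4 : delta * delta <= kap * eta / 8.
    by apply: le_trans delta2; rewrite -[leRHS]mul1r ler_wpM2r// ltW.
  have d5 := ler_wpM2l (exprn_ge0 5 (ltW Lp)) d4.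
  have d6 := ler_wpM2l (exprn_ge0 4 (ltW Lp)) l2.
  by move: hen d5 d6; rewrite /lam; clear; lra.
move=> w Gw t x /andP[t0 tT] /andP[x0 x1].
(* [r] is within 1 of L^2 t, hence within 1 / L^2 of [t] after scaling. *)
have [r [/andP[r1 r2] r3 va' en]] := HG w Gw (L%:R ^+ 2 * t) 1
  ltac:(by rewrite mulr_ge0 ?(ltW L2p)//= ltr_pM2l// (le_lt_trans tT)// ltrDl) ltr01.
have r0 : 0 <= r by apply: le_trans r1; rewrite mulr_ge0// ltW.
have rL0 : 0 <= r / L%:R ^+ 2 by rewrite divr_ge0// ltW.
pose y := Num.truncn (x * L%:R).
have y1 : y%:R <= x * L%:R by rewrite truncn_le// mulr_ge0// ltW.
have y2 : x * L%:R < y%:R + 1 by rewrite natr1 truncnS_gt.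
have yL : (y <= L)%N.
  by rewrite -(@ler_nat R); apply: le_trans y1 _; rewrite -[leRHS]mul1r ler_wpM2r// ltW.
have close z : (z <= L)%N -> `|discrete_heat L e s r z - L%:R * phi (z%:R / L%:R) (r / L%:R ^+ 2)|
    <= L%:R * (eps / 16).
  move=> zL; apply: le_trans (near_phi r z zL _) _; first by rewrite r0.
  by have := ler_wpM2l (ltW Lp) delta3; move: l3; clear; lra.
have := energy_sup L e (discrete_heat L e s r) (fun z => phi (z%:R / L%:R) (r / L%:R ^+ 2)) _
  eps K rho L0 va' (discrete_heat0 _ _ _ _) (discrete_heatL _ _ _ _ L0) eps0 K1 erefl l4 close _ en y yL.
move=> /(_ _) H.
have {H} dev : `|deviation (discrete_heat L e s r) (h L w (L%:R ^+ 2 * t)) y| <= L%:R * (eps / 2).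
  apply: H => z z' zL zL'; have := HK _ _ _ _ (frac z zL) (frac z' zL') rL0 rL0.
  by rewrite subrr normr0 addr0.
have x01 : 0 <= x <= 1 by rewrite x0.
have := HK _ _ _ _ (frac y yL) x01 rL0 t0.
have g1 : `|y%:R / L%:R - x| <= L%:R^-1.
  have -> : y%:R / L%:R - x = (y%:R - x * L%:R) / L%:R by field; rewrite gt_eqF.
  rewrite normrM normfV (gtr0_norm Lp) ler_piMl ?invr_ge0 ?ltW//.
  by rewrite ltr_norml; apply/andP; split; move: y1 y2; clear; lra.
have g2 : `|r / L%:R ^+ 2 - t| <= L%:R^-1.
  have -> : r / L%:R ^+ 2 - t = (r - L%:R ^+ 2 * t) / L%:R ^+ 2 by field; rewrite gt_eqF.
  rewrite normrM normfV (gtr0_norm L2p) ger0_norm ?subr_ge0//.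
  rewrite ler_pdivrMr// expr2 mulKf ?gt_eqF//.
  by apply: le_trans L1; move: r2; clear; lra.
move=> g3; have {}g3 := le_trans g3 (lerD (lexx _) (ler_wpM2l (ltW Kp) (lerD g1 g2))).
have g4 := ler_wpM2l (ltW Lp) g3.
rewrite mulrDr (_ : L%:R * (K * (L%:R^-1 + L%:R^-1)) = 2 * K) in g4; last by field; rewrite gt_eqF.
rewrite -[X in X * `|_|](gtr0_norm Lp) -normrM in g4.
rewrite ler_pdivrMr//; move: g4 (close y yL) dev; rewrite /deviation.
set A := (nth _ _ _)%:~R; set B := discrete_heat _ _ _ _ _; set D := phi _ (r / _); set E := phi x t.
move=> g4 c4 dev; have -> : A - L%:R * E = (A - B) + (B - L%:R * D) + L%:R * (D - E) by ring.
apply: le_trans (ler_normD _ _) _; apply: le_trans (lerD (ler_normD _ _) (lexx _)) _.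
(* In units of L eps: 1/2 from [dev], 1/16 from [close], 1/8 + 1/16 from the modulus of [phi]. *)
have pos : 0 < L%:R * eps by rewrite mulr_gt0.
by move: g4 c4 dev l5 pos; clear; lra.
Qed.
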